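(* Let $\eta\in(0,1)$, $K,\tilde K\in\mathcal{K}_\eta$, $\alpha\in(\eta,1]$, and $Q,\tilde Q\in\mathcal{Q}_\alpha$. Let $M>0$ be a constant such that $\|K\|_{\mathcal{K}_\eta}\vee\|\tilde K\|_{\mathcal{K}_\eta}\vee\|Q\|_{\mathcal{Q}_\alpha}\vee\|\tilde Q\|_{\mathcal{Q}_\alpha}\le M$. Then for any $\zeta\in[0,\alpha-\eta)$ there is a constant $C_M$ depending on $M$ such that $$\|\mathcal{I}(K,Q)-\mathcal{I}(\tilde K,\tilde Q)\|_{\mathcal{Q}_\zeta}\le C_M\big(\|K-\tilde K\|_{\mathcal{K}_\eta}+\|Q-\tilde Q\|_{\mathcal{Q}_\alpha}\big),$$ where $\mathcal{I}(K,Q):[0,T]^2\to\mathcal{L}(H)$ is given by $\mathcal{I}(K,Q)(t,t')=\int_0^t\int_0^{t'}K(t,r)\,d^2Q(r,r')\,K(t',r')^*$. The constant $C_M$ does not depend on $K,\tilde K,Q,\tilde Q$ other than through $M$.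
   Context: $T>0$, $H$ is a separable real Hilbert space, $\mathcal{L}(H)$ the bounded linear operators on $H$ with operator norm $\|\cdot\|_{op}$, $^*$ the adjoint, $\Delta_2^T=\{(t,s)\in[0,T]^2:t\ge s\}$, $a\vee b=\max(a,b)$. Rectangular increment: $\square_{(s,s'),(t,t')}f=f(t,t')-f(t,s')-f(s,t')+f(s,s')$. Kernels: for $\eta\in(0,1)$, $\mathcal{K}_\eta$ is the space of maps $K:\Delta_2^T\to\mathcal{L}(H)$ with $\|K\|_{\mathcal{K}_\eta}:=\sum_{i=1}^4\|K\|_{\eta,i}<\infty$, where $\|K\|_{\eta,1}=\sup_{t>s}\frac{\|K(t,s)\|_{op}}{|t-s|^{-\eta}}$, $\|K\|_{\eta,2}=\sup_{t>u>s,\ \theta\in[0,1]}\frac{\|K(t,s)-K(u,s)\|_{op}}{|t-u|^\theta|u-s|^{-\theta-\eta}}$, $\|K\|_{\eta,3}=\sup_{t>u>s,\ \theta\in[0,1]}\frac{\|K(t,u)-K(t,s)\|_{op}}{|u-s|^\theta|t-u|^{-\theta-\eta}}$, $\|K\|_{\eta,4}=\sup_{\tau'>\tau>s>r,\ \theta,\nu\in[0,1]}\frac{\|K(\tau',s)-K(\tau',r)-K(\tau,s)+K(\tau,r)\|_{op}}{|\tau-s|^{-\nu-\theta-\eta}|\tau'-\tau|^\nu|s-r|^\theta}$ (all times in $[0,T]$; values on the diagonal play no role). Regular covariance operators: for $\alpha\in[0,1]$, $\mathcal{Q}_\alpha$ is the class of $Q:[0,T]^2\to\mathcal{L}(H)$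 with $\|Q\|_{\mathcal{Q}_\alpha}:=\|Q\|_{\alpha,(1,0)}+\|Q\|_{\alpha,(0,1)}+\|Q\|_{\alpha,(1,1)}<\infty$, where $\|Q\|_{\alpha,(1,0)}=\sup_{t>s,\,t'}\frac{\|Q(t,t')-Q(s,t')\|_{op}}{|t-s|^\alpha}$, $\|Q\|_{\alpha,(0,1)}=\sup_{t,\,t'>s'}\frac{\|Q(t,t')-Q(t,s')\|_{op}}{|t'-s'|^\alpha}$, $\|Q\|_{\alpha,(1,1)}=\sup_{t>s,\,t'>s'}\frac{\|\square_{(s,s'),(t,t')}Q\|_{op}}{(|t-s||t'-s'|)^\alpha}$. The double integral $\int_0^t\int_0^{t'}K(t,r)d^2Q(r,r')K(t',r')^*$ is the limit in operator norm, as the meshes of the partitions $\mathcal{P}$ of $[0,t]$ and $\mathcal{P}'$ of $[0,t']$ tend to $0$, of $\sum_{[u,v]\in\mathcal{P},[u',v']\in\mathcal{P}'}K(t,u)\,\square_{(u,u'),(v,v')}Q\,K(t',u')^*$; this limit exists under the stated hypotheses. *)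

(* Defs.v *)
From HB Require Import structures.
From mathcomp Require Import all_boot all_order all_algebra.
From mathcomp Require Import sesquilinear.
From mathcomp Require Import all_classical all_reals all_analysis.

Set Implicit Arguments.
Unset Strict Implicit.
Unset Printing Implicit Defensive.

Import Order.TTheory GRing.Theory Num.Theory.
Import numFieldNormedType.Exports.

Local Open Scope classical_set_scope.
Local Open Scope ring_scope.

Definition separable_space (V : topologicalType) : Prop :=
  exists2 D : set V, countable D & dense D.

Section BoundedOperator.
Context {R : realType} {V : normedModType R}.

Definition bounded_op : pred (V -> V) := fun f =>
  `[< linear f /\ exists M : R, forall x, `|f x| <= M * `|x| >].

Record bop : Type := Bop { bop_fun :> V -> V ; _ : bop_fun \in bounded_op }.

HB.instance Definition _ := [isSub for bop_fun].
HB.instance Definition _ := [Choice of bop by <:].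

Lemma bounded_op_submod : submod_closed bounded_op.
Proof.
split.
  apply/asboolP; split; first by move=> a x y /=; rewrite scaler0 addr0.
  by exists 0 => x; rewrite normr0 mul0r.
move=> a f g /asboolP[lf [M fM]] /asboolP[lg [N gN]]; apply/asboolP; split.
  move=> k x y /=; rewrite !fctE lf lg !scalerDr !scalerA mulrC.
  by rewrite -!addrA; congr (_ + _); rewrite addrCA.
exists (`|a| * M + N) => x; rewrite !fctE mulrDl.
apply: (le_trans (ler_normD _ _)); apply: lerD; last exact: gN.
by rewrite normrZ -mulrA; apply: ler_wpM2l => //; exact: fM.
Qed.

HB.instance Definition _ :=
  GRing.isSubmodClosed.Build R (V -> V) bounded_op bounded_op_submod.
HB.instance Definition _ := [SubChoice_isSubLmodule of bop by <:].

Lemma bop_linear (A : bop) : linear A.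
Proof. by have /asboolP[] := valP A. Qed.

HB.instance Definition _ (A : bop) :=
  GRing.isLinear.Build R V V *:%R A (bop_linear A).

Lemma bop_bounded (A : bop) : exists M : R, forall x, `|A x| <= M * `|x|.
Proof. by have /asboolP[] := valP A. Qed.

Definition opnorm (A : bop) : R :=
  sup [set r | exists2 x, `|x| <= 1 & r = `|A x|].

Lemma opnorm_has_sup (A : bop) :
  has_sup [set r | exists2 x, `|x| <= 1 & r = `|A x|].
Proof.
split; first by exists `|A 0|, 0; rewrite ?normr0.
have [M AM] := bop_bounded A; exists `|M| => _ [x x1 ->].
rewrite (le_trans (AM x))// (le_trans (ler_norm _))// normrM normr_id.
by rewrite -[leRHS]mulr1 ler_wpM2l.
Qed.

Lemma opnorm_ge (A : bop) x : `|x| <= 1 -> `|A x| <= opnorm A.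
Proof.
by move=> x1; apply: ub_le_sup; [case: (opnorm_has_sup A)|exists x].
Qed.

Lemma opnorm_le (A : bop) (M : R) :
  (forall x, `|x| <= 1 -> `|A x| <= M) -> opnorm A <= M.
Proof.
move=> AM; apply: ge_sup; first by case: (opnorm_has_sup A).
by move=> _ [x x1 ->]; exact: AM.
Qed.

Lemma opnorm_ge0 (A : bop) : 0 <= opnorm A.
Proof. by rewrite (le_trans _ (@opnorm_ge A 0 _))// normr0. Qed.

Lemma opnormP (A : bop) x : `|A x| <= opnorm A * `|x|.
Proof.
have [->|x0] := eqVneq x 0; first by rewrite linear0 !normr0 mulr0.
have nx : 0 < `|x| by rewrite normr_gt0.
have : `|A (`|x|^-1 *: x)| <= opnorm A.
  by apply: opnorm_ge; rewrite normrZ normfV normr_id mulVf ?gt_eqF.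
by rewrite linearZ normrZ normfV normr_id mulrC ler_pdivrMr.
Qed.

Lemma ler_opnormD (A B : bop) : opnorm (A + B) <= opnorm A + opnorm B.
Proof.
apply: opnorm_le => x x1; rewrite (le_trans (ler_normD (A x) (B x)))//.
by apply: lerD; exact: opnorm_ge.
Qed.

Lemma opnormZ (a : R) (A : bop) : opnorm (a *: A) = `|a| * opnorm A.
Proof.
have le1 (b : R) (B : bop) : opnorm (b *: B) <= `|b| * opnorm B.
  apply: opnorm_le => x x1; rewrite [X in `|X|](_ : _ = b *: B x)// normrZ.
  by rewrite ler_wpM2l// opnorm_ge.
apply/le_anti; rewrite le1/=.
have [->|a0] := eqVneq a 0; first by rewrite normr0 mul0r opnorm_ge0.
have := le1 a^-1 (a *: A); rewrite scalerA mulVf// scale1r => h.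
by rewrite mulrC -ler_pdivlMr ?normr_gt0// mulrC -normfV.
Qed.

Lemma opnorm0_eq0 (A : bop) : opnorm A = 0 -> A = 0.
Proof.
move=> A0; apply/val_inj/funext => x /=; apply/normr0_eq0/le_anti.
by rewrite normr_ge0 andbT (le_trans (opnormP A x))// A0 mul0r.
Qed.

HB.instance Definition _ :=
  Lmodule_isNormed.Build R bop ler_opnormD opnormZ opnorm0_eq0.

Lemma bop_comp_subproof (A B : bop) : (A \o B : V -> V) \in bounded_op.
Proof.
apply/asboolP; split; first by move=> k x y /=; rewrite !linearP.
exists (opnorm A * opnorm B) => x /=; rewrite (le_trans (opnormP A _))//.
by rewrite -mulrA ler_wpM2l ?opnorm_ge0// opnormP.
Qed.

Definition bop_comp (A B : bop) : bop := Bop (bop_comp_subproof A B).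

End BoundedOperator.
Arguments bop {R} V.

Notation "''L' ( V )" := (bop V) (at level 8, format "''L' ( V )") : type_scope.
Notation "A \oL B" := (bop_comp A B)
  (at level 40, left associativity) : ring_scope.

(* The adjoint with respect to the inner product [dot]: the operator B with
   <A x, y> = <x, B y>.  On a Hilbert space it exists (Riesz) and is unique. *)
Definition adjoint (R : realType) (V : normedModType R)
    (dot : {dot V for idfun}) (A : 'L(V)) : 'L(V) :=
  get [set B : 'L(V) | forall x y, dot (A x) y = dot x (B y)].

(* Functions on [0,T]^2, or on the triangle {s <= t} in it, are represented by
   functions on R^2 whose values elsewhere are irrelevant.  A kernel K takes its
   arguments in the order K t s with s <= t.  Norms are valued in \bar R, so
   that they are defined for every function. *)

Section Norms.
Context {R : realType} {V : normedModType R} (T : R).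
Local Open Scope ereal_scope.

(* The increment over the rectangle with corners (s,s') and (t,t'). *)
Definition rect_incr (f : R -> R -> V) (s s' t t' : R) : V :=
  (f t t' - f t s' - f s t' + f s s')%R.

Definition knorm1 (eta : R) (K : R -> R -> V) : \bar R :=
  ereal_sup [set x | exists t s : R, (0 <= s < t)%R /\ (t <= T)%R /\
    x = (`|K t s| / `|t - s| `^ (- eta))%:E].

Definition knorm2 (eta : R) (K : R -> R -> V) : \bar R :=
  ereal_sup [set x | exists t u s theta : R,
    (0 <= s < u)%R /\ (u < t <= T)%R /\ (0 <= theta <= 1)%R /\
    x = (`|K t s - K u s|
         / (`|t - u| `^ theta * `|u - s| `^ (- theta - eta)))%:E].

Definition knorm3 (eta : R) (K : R -> R -> V) : \bar R :=
  ereal_sup [set x | exists t u s theta : R,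
    (0 <= s < u)%R /\ (u < t <= T)%R /\ (0 <= theta <= 1)%R /\
    x = (`|K t u - K t s|
         / (`|u - s| `^ theta * `|t - u| `^ (- theta - eta)))%:E].

Definition knorm4 (eta : R) (K : R -> R -> V) : \bar R :=
  ereal_sup [set x | exists tau' tau s r theta nu : R,
    (0 <= r < s)%R /\ (s < tau)%R /\ (tau < tau' <= T)%R /\
    (0 <= theta <= 1)%R /\ (0 <= nu <= 1)%R /\
    x = (`|K tau' s - K tau' r - K tau s + K tau r|
         / (`|tau - s| `^ (- nu - theta - eta)
            * `|tau' - tau| `^ nu * `|s - r| `^ theta))%:E].

Definition kernel_norm (eta : R) (K : R -> R -> V) : \bar R :=
  knorm1 eta K + knorm2 eta K + knorm3 eta K + knorm4 eta K.

Definition kernel_class (eta : R) : set (R -> R -> V) :=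
  [set K | kernel_norm eta K < +oo].

Definition qnorm10 (alpha : R) (Q : R -> R -> V) : \bar R :=
  ereal_sup [set x | exists t s t' : R,
    (0 <= s < t)%R /\ (t <= T)%R /\ (0 <= t' <= T)%R /\
    x = (`|Q t t' - Q s t'| / `|t - s| `^ alpha)%:E].

Definition qnorm01 (alpha : R) (Q : R -> R -> V) : \bar R :=
  ereal_sup [set x | exists t t' s' : R,
    (0 <= t <= T)%R /\ (0 <= s' < t')%R /\ (t' <= T)%R /\
    x = (`|Q t t' - Q t s'| / `|t' - s'| `^ alpha)%:E].

Definition qnorm11 (alpha : R) (Q : R -> R -> V) : \bar R :=
  ereal_sup [set x | exists t s t' s' : R,
    (0 <= s < t)%R /\ (t <= T)%R /\ (0 <= s' < t')%R /\ (t' <= T)%R /\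
    x = (`|rect_incr Q s s' t t'| / (`|t - s| * `|t' - s'|) `^ alpha)%:E].

Definition cov_norm (alpha : R) (Q : R -> R -> V) : \bar R :=
  qnorm10 alpha Q + qnorm01 alpha Q + qnorm11 alpha Q.

Definition cov_class (alpha : R) : set (R -> R -> V) :=
  [set Q | cov_norm alpha Q < +oo].

End Norms.

Section DoubleIntegral.
Context {R : realType}.

(* As in [itv_partition], a partition of [a, b] is a :: P with P ending in b;
   [subitvs a P] lists its intervals [u, v] as pairs (u, v). *)
Definition subitvs (a : R) (P : seq R) : seq (R * R) := zip (a :: P) P.

Definition mesh (a : R) (P : seq R) : R :=
  \big[Num.max/0]_(p <- subitvs a P) (p.2 - p.1).

Definition mesh_to0 (a b : R) : set_system (seq R) :=
  [set S | exists2 delta : R, 0 < delta &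
     forall P, itv_partition a b P -> mesh a P < delta -> S P].

Context {V : normedModType R} (dot : {dot V for idfun}).

Definition double_sum (K Q : R -> R -> 'L(V)) (t t' : R) (P P' : seq R) : 'L(V) :=
  \sum_(p <- subitvs 0 P) \sum_(p' <- subitvs 0 P')
    (K t p.1 \oL rect_incr Q p.1 p'.1 p.2 p'.2 \oL adjoint dot (K t' p'.1)).

(* The limit is in the topology of 'L(V), which is that of [opnorm]. *)
Definition double_integral (K Q : R -> R -> 'L(V)) (t t' : R) : 'L(V) :=
  lim (double_sum K Q t t' PP.1 PP.2
         @[PP --> filter_prod (mesh_to0 0 t) (mesh_to0 0 t')]).

End DoubleIntegral.

(* Main.v *)
(* By trilinearity it suffices to bound the integral of K against Q against L.
   For fixed t, a kernel r |-> K t r of the class is locally Lipschitz with a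
   singularity at t, so summation by parts controls its Riemann-Stieltjes sums
   against an alpha-Hoelder function f: inserting w1 between w and v costs
   |K t w1 - K t w| |f v - f w1| <~ (t - w1)^(alpha - eta) (w1 - w) / (t - w),
   which is dominated by the increment of r |-> (t - r)^(alpha - eta).  This
   bounds the sums, makes them Cauchy in the mesh, and, applied to
   K t - K s on [0, s] (with exponent eta + zeta) and to K t on [s, t], bounds
   the increment from s to t of the sums by (t - s)^zeta.  A functional bounded
   on alpha-Hoelder functions maps the family Q (., r') to a Hoelder function
   of r', so the two-parameter sums are compositions of one-parameter ones and
   inherit the product bounds.  The integral vanishes when t or t' is 0, so the
   one-parameter seminorms are instances of the rectangular one. *)

From HB Require Import structures.
Require Import Defs.
From mathcomp Require Import all_boot all_order all_algebra.
From mathcomp Require Import sesquilinear ring lra.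
From mathcomp Require Import all_classical all_reals all_analysis.

Set Implicit Arguments.
Unset Strict Implicit.
Unset Printing Implicit Defensive.

Import Order.TTheory GRing.Theory Num.Theory.
Import numFieldNormedType.Exports.

Local Open Scope classical_set_scope.
Local Open Scope ring_scope.

(** * Partitions *)

Section Partitions.
Context {R : realType}.
Implicit Types (a b u v D : R) (P Q : seq R).

Lemma mesh_cons a v P : mesh a (v :: P) = Num.max (v - a) (mesh v P).
Proof. by rewrite /mesh /subitvs /= big_cons. Qed.

Lemma mesh_nil a : mesh a [::] = 0.
Proof. by rewrite /mesh /subitvs /= big_nil. Qed.

Lemma mesh_ge0 a P : 0 <= mesh a P.
Proof. by elim: P a => [|v P IH] a; rewrite ?mesh_nil// mesh_cons le_max IH orbT. Qed.

Lemma mesh_cat a b P Q : itv_partition a b P ->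
  mesh a (P ++ Q) = Num.max (mesh a P) (mesh b Q).
Proof.
elim: P a => [a /itv_partition_nil <-|v P IH a /itv_partition_cons vP] /=.
  by rewrite mesh_nil max_r // mesh_ge0.
by rewrite !mesh_cons (IH v vP) maxA.
Qed.

Lemma mem_itv_partition a b P x : itv_partition a b P -> x \in P -> a < x <= b.
Proof.
elim: P a => // v P IH a abP; rewrite inE => /predU1P[->|xP].
  by case: (abP) => /= /andP[-> _] _ /=; exact: itv_partition_le (itv_partition_cons abP).
case: (abP) => /= /andP[av _] _.
by have /andP[vx ->] := IH _ (itv_partition_cons abP) xP; rewrite (lt_trans av vx).
Qed.

(** The refinement is the sorted union of the points. A partition is strictly increasing, so
    filtering the union by membership in it gives it back as a subsequence. *)
Lemma common_refinement a b P Q : itv_partition a b P -> itv_partition a b Q ->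
  exists S, [/\ itv_partition a b S, subseq P S & subseq Q S].
Proof.
move=> abP abQ; have [/eqP P0|/[dup] P0] := boolP (P == [::]).
  have ab : a = b by move: abP; rewrite P0 => /itv_partition_nil.
  by exists Q; split=> //; rewrite P0 sub0seq.
rewrite -size_eq0 -lt0n => sP.
have ab := itv_partition_size_neq0 sP abP.
set S := sort <=%O (undup (P ++ Q)).
have sS : sorted <%O S by rewrite sort_lt_sorted undup_uniq.
have memS x : (x \in S) = (x \in P) || (x \in Q).
  by rewrite mem_sort mem_undup mem_cat.
have lub x : x \in S -> a < x <= b.
  by rewrite memS => /orP[]; apply: mem_itv_partition.
have sub Z : itv_partition a b Z -> {subset Z <= S} -> subseq Z S.
  move=> [aZ _] ZS; suff -> : Z = [seq x <- S | x \in Z] by exact: filter_subseq.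
  apply: lt_sorted_eq; [exact: path_sorted aZ|exact: lt_sorted_filter|].
  by move=> x; rewrite mem_filter; case: (boolP (x \in Z)) => // /ZS ->.
have bS : b \in S.
  by rewrite memS; case: abP P0 => _ /eqP <-; case: (P) => //= p s _; rewrite mem_last.
exists S; split; [|by apply: sub => // x; rewrite memS => ->|
  by apply: sub => // x; rewrite memS => ->; rewrite orbT].
have aS : path <%O a S.
  by rewrite lt_path_sortedE sS andbT; apply/allP => x /lub/andP[].
split=> //; rewrite eq_le.
have S0 : S != [::] by apply: contraTneq bS => ->.
have lS : last a S \in S by case: (S) S0 => //= p s _; rewrite mem_last.
have /andP[_ ->] := lub _ lS; rewrite /=.
have [S1 [S2 ES]] : exists S1 S2, S = S1 ++ b :: S2.
  by case/splitPr: bS => S1 S2; exists S1, S2.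
move: aS; rewrite ES last_cat /= cat_path /= => /and3P[_ _].
by move=> bS2; apply: (@itv_partition_le _ _ _ _ S2).
Qed.

Lemma exists_fine_partition a b D : a <= b -> 0 < D ->
  exists2 P, itv_partition a b P & mesh a P < D.
Proof.
move=> ab D0.
(* Induction on the number of steps of length [D / 2]; the half leaves room for the strict bound on
   the mesh. *)
have [n] : exists n : nat, b - a < D / 2 * n%:R.
  exists (Num.bound ((b - a) / (D / 2))).
  have D20 : 0 < D / 2 by rewrite divr_gt0.
  rewrite -ltr_pdivrMl// mulrC; apply: archi_boundP.
  by rewrite divr_ge0 ?subr_ge0// ltW.
elim: n a ab => [|n IH] a ab nD; first by lra.
have [->|ab'] := eqVneq a b.
  by exists [::]; [split=> /=|rewrite mesh_nil].
have {}ab : a < b by rewrite lt_neqAle ab' ab.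
have [bD|bD] := leP (b - a) (D / 2).
  exists [:: b]; first exact: itv_partition1.
  by rewrite mesh_cons mesh_nil gt_max D0 andbT; lra.
have [||P [aP lP] mP] := IH (a + D / 2); [lra| |].
  by have n1 : n.+1%:R = n%:R + 1 :> R; [rewrite natr1|move: nD; rewrite n1; lra].
exists (a + D / 2 :: P); first by split => //=; rewrite aP andbT; lra.
by rewrite mesh_cons gt_max mP andbT; lra.
Qed.

(** Properness is the existence of arbitrarily fine partitions, and it gives limits along [mesh_to0]
    a meaning. *)
Lemma mesh_to0_filter a b : a <= b -> ProperFilter (mesh_to0 a b).
Proof.
move=> ab; split=> [[D D0 h]|].
  by have [P abP mP] := exists_fine_partition ab D0; apply: h mP.
split; first by exists 1.
  move=> A B [D D0 hA] [E E0 hB]; exists (Num.min D E); first by rewrite lt_min D0.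
  by move=> P abP; rewrite lt_min => /andP[mD mE]; split; [apply: hA|apply: hB].
by move=> A B AB [D D0 hA]; exists D => // P abP mP; apply/AB/hA.
Qed.

End Partitions.

(** With z = x / y the claim reads kap (1 - 1/z) <= z^kap - 1. It follows from 1 - 1/z <= ln z and
    from 1 + u <= exp u at u = kap ln z. *)
Lemma powR_telescope (R : realType) (kap x y : R) : 0 < kap -> 0 < y -> y <= x ->
  y `^ kap * ((x - y) / x) <= kap^-1 * (x `^ kap - y `^ kap).
Proof.
move=> k0 y0 yx; have x0 : 0 < x by apply: lt_le_trans yx.
rewrite ler_pdivlMl// mulrCA.
have -> : x `^ kap = y `^ kap * (x / y) `^ kap.
  by rewrite -powRM ?divr_ge0 ?ltW// mulrC divfK// gt_eqF.
rewrite -[X in _ <= _ - X]mulr1 -mulrBr ler_wpM2l ?powR_ge0//.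
have lnz : (x - y) / x <= ln (x / y).
  have : ln (y / x) <= y / x - 1.
    have {1}-> : y / x = 1 + (y / x - 1) by rewrite addrC subrK.
    by apply: le_ln1Dx; have := divr_gt0 y0 x0; lra.
  rewrite -[x / y]invrK invf_div lnV ?posrE ?divr_gt0// mulrBl divff ?gt_eqF//.
  by rewrite lerNr opprB.
rewrite /powR gt_eqF ?divr_gt0//.
have := expR_ge1Dx (kap * ln (x / y)).
rewrite -lerBrDl; apply: le_trans.
by rewrite ler_wpM2l// ltW.
Qed.

(** * One-parameter sums *)

Section SingularSums.
Context {R : realType} {F E : normedModType R}.
Context (mul : F -> E -> E).
Hypothesis mulBl : forall x y z, mul (x - y) z = mul x z - mul y z.
Hypothesis mulBr : forall x y z, mul x (y - z) = mul x y - mul x z.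
Hypothesis norm_mul : forall x y, `|mul x y| <= `|x| * `|y|.
Implicit Types (k : R -> F) (f g : R -> E) (P S : seq R) (a b : R).

(** The product [mul] is abstract because two instances are needed: composition with [K t r] on the
    left and with the adjoint of [K t' r'] on the right. *)
Definition left_sum k f a P : E :=
  \sum_(p <- subitvs a P) mul (k p.1) (f p.2 - f p.1).

(* The second bound is, up to constants, the minimum of [(b - u) `^ (- eta)] and
   [(u - r) * (b - u) `^ (- eta - 1)], i.e. of theta = 0 and theta = 1 in
   [knorm3] and [knorm4]. *)
Definition singular_at N eta a b k :=
  (forall r, a <= r < b -> `|k r| <= N * (b - r) `^ (- eta)) /\
  (forall r u, a <= r < u -> u < b ->
     `|k u - k r| <= N * (b - u) `^ (- eta) * ((u - r) / (b - r))).

Definition holder_on alpha c a b f :=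
  forall u v, a <= u < v -> v <= b -> `|f v - f u| <= c * (v - u) `^ alpha.

Lemma left_sum_nil k f a : left_sum k f a [::] = 0.
Proof. by rewrite /left_sum /subitvs big_nil. Qed.

Lemma left_sum_cons k f a v P :
  left_sum k f a (v :: P) = mul (k a) (f v - f a) + left_sum k f v P.
Proof. by rewrite /left_sum /subitvs /= big_cons. Qed.

Lemma left_sum_cat k f a b P S : itv_partition a b P ->
  left_sum k f a (P ++ S) = left_sum k f a P + left_sum k f b S.
Proof.
elim: P a => [a /itv_partition_nil <-|v P IH a /itv_partition_cons vP] /=.
  by rewrite left_sum_nil add0r.
by rewrite !left_sum_cons IH// addrA.
Qed.

Lemma left_sumBl k l f a P :
  left_sum (k - l) f a P = left_sum k f a P - left_sum l f a P.
Proof. by rewrite -sumrB; apply: eq_bigr => p _; rewrite fctE mulBl. Qed.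

Lemma left_sumBr k f g a P :
  left_sum k (f - g) a P = left_sum k f a P - left_sum k g a P.
Proof.
rewrite -sumrB; apply: eq_bigr => p _; rewrite !fctE -mulBr; congr mul.
by rewrite opprD addrACA -opprD.
Qed.

(* Inserting the points of S into P from left to right, each new point w1
   replaces [k w] by [k w1] against the increment of [f] from w1 to the next
   point of P; by [powR_telescope] the costs sum up. *)
Lemma left_sum_refine N eta alpha c d D a b k f P S :
  0 <= N -> 0 <= c -> 0 <= d <= alpha -> eta + d < alpha ->
  singular_at N eta a b k -> holder_on alpha c a b f ->
  itv_partition a b S -> itv_partition a b P -> subseq P S -> mesh a P <= D ->
  `|left_sum k f a S - left_sum k f a P| <=
    N * c * D `^ d * ((alpha - eta - d)^-1 * (b - a) `^ (alpha - eta - d)).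
Proof.
move=> N0 c0 /andP[d0 dalpha] kap_gt0 [_ k_inc] f_hol abS abP PS mP.
set kap := alpha - eta - d; have k0 : 0 < kap by rewrite /kap; lra.
(* The left end [w] varies while the singularity [b] stays fixed; (b - w)^kap is the budget from
   which each inserted point is paid. *)
suff: forall w, a <= w -> itv_partition w b S -> itv_partition w b P ->
    mesh w P <= D -> `|left_sum k f w S - left_sum k f w P| <=
    N * c * D `^ d * (kap^-1 * (b - w) `^ kap) by apply.
clear abS abP mP; have C0 x : 0 <= N * c * D `^ d * (kap^-1 * x `^ kap).
  by rewrite !mulr_ge0 ?invr_ge0 ?powR_ge0// ltW.
elim: S P PS => [|w1 S IH] P PS w aw wS wP mP.
  by move: PS; rewrite subseq0 => /eqP ->; rewrite subrr normr0.
case: P => [|v P] in PS wP mP *.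
  have := itv_partition_size_neq0 (s := w1 :: S) isT wS.
  by rewrite (itv_partition_nil wP) ltxx.
have wS1 := itv_partition_cons wS; have vP := itv_partition_cons wP.
have ww1 : w < w1 by case: wS => /= /andP[].
have aw1 : a <= w1 by rewrite (le_trans aw) ?ltW.
move: mP; rewrite mesh_cons ge_max => /andP[vwD mP].
move: PS => /=; case: eqP => [vw1|vw1] PS.
  rewrite !left_sum_cons -vw1 opprD addrACA subrr add0r.
  apply: le_trans (IH P PS v _ _ vP mP) _; rewrite ?vw1//.
  rewrite !ler_wpM2l ?mulr_ge0 ?invr_ge0 ?powR_ge0 ?(ltW k0)//.
  have := itv_partition_le wS1.
  by move=> w1b; apply: ge0_ler_powR; rewrite ?nnegrE ?(ltW k0)//; lra.
have /andP[w1v vb] : w1 < v <= b.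
  by apply: mem_itv_partition wS1 _; apply: (mem_subseq PS); rewrite mem_head.
have w1P : itv_partition w1 b (v :: P).
  by case: vP => vP lP; split=> //=; rewrite w1v.
have -> : left_sum k f w (w1 :: S) - left_sum k f w (v :: P) =
    (left_sum k f w1 S - left_sum k f w1 (v :: P))
    + mul (k w1 - k w) (f v - f w1).
  have grp (x y z s t : E) : x + s - (y + x + t) = s - (z + t) + (z - y).
    rewrite [z + t]addrC [- (t + z)]opprD (addrA s) subrKA [x + s]addrC.
    by rewrite [y + x + t]addrAC opprD addrACA subrr addr0 [y + t]addrC opprD addrA.
  rewrite !left_sum_cons mulBl.
  have -> : mul (k w) (f v - f w) = mul (k w) (f v - f w1) + mul (k w) (f w1 - f w).
    by rewrite !mulBr addrA subrK.
  exact: grp.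
apply: le_trans (ler_normD _ _) _.
have m1 : mesh w1 (v :: P) <= D by rewrite mesh_cons ge_max mP andbT; lra.
apply: le_trans (lerD (IH _ PS w1 aw1 wS1 w1P m1) (norm_mul _ _)) _.
(* What remains is that the cost of inserting [w1] is at most the drop of the budget from [w] to
   [w1]. *)
rewrite -lerBrDl -!mulrBr.
have bw1 : 0 < b - w1 by lra.
(* Since [v - w1] is at most both [D] and [b - w1], the exponent [alpha] can be divided: the part
   [d] becomes a power of the mesh, and the part [alpha - d] compensates the singularity at [b]. *)
have vw1D : (v - w1) `^ alpha <= D `^ d * (b - w1) `^ (alpha - d).
  have {1}-> : alpha = d + (alpha - d) by lra.
  rewrite powRD; last by apply/implyP => _; rewrite gt_eqF// subr_gt0.
  by apply: ler_pM; rewrite ?powR_ge0//; apply: ge0_ler_powR; rewrite ?nnegrE//; lra.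
have kf : `|k w1 - k w| * `|f v - f w1| <=
   (N * (b - w1) `^ (- eta) * ((w1 - w) / (b - w))) *
   (c * (D `^ d * (b - w1) `^ (alpha - d))).
  apply: ler_pM => //; first by apply: k_inc; lra.
  apply: le_trans (f_hol w1 v _ vb) _; first by rewrite aw1.
  by rewrite ler_wpM2l.
apply: le_trans kf _.
have -> : (b - w1) `^ (alpha - d) = (b - w1) `^ kap / (b - w1) `^ (- eta).
  rewrite -powRB; last by apply/implyP => _; rewrite gt_eqF.
  by congr powR; rewrite /kap; lra.
have p0 : (b - w1) `^ (- eta) != 0 by rewrite gt_eqF// powR_gt0.
have -> : N * (b - w1) `^ (- eta) * ((w1 - w) / (b - w)) *
    (c * (D `^ d * ((b - w1) `^ kap / (b - w1) `^ (- eta)))) =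
  N * c * D `^ d * ((b - w1) `^ kap * ((w1 - w) / (b - w))).
  by field; rewrite p0 /=; lra.
rewrite ler_wpM2l// ?mulr_ge0 ?powR_ge0//.
have := @powR_telescope _ kap (b - w) (b - w1) k0 bw1.
have -> : b - w - (b - w1) = w1 - w by lra.
by apply; lra.
Qed.

(** Comparison with the one-interval partition [[:: b]], at [d = 0] so that no power of the mesh
    remains. The sum over that partition is the single product of [k a] and [f b - f a], which
    accounts for the 1 in the constant. *)
Lemma left_sum_bound N eta alpha c a b k f P :
  0 <= N -> 0 <= c -> 0 <= alpha -> eta < alpha ->
  singular_at N eta a b k -> holder_on alpha c a b f -> itv_partition a b P ->
  `|left_sum k f a P| <=
    (1 + (alpha - eta)^-1) * (N * c * (b - a) `^ (alpha - eta)).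
Proof.
move=> N0 c0 alpha0 ea kS fH abP.
have ae0 : 0 < alpha - eta by lra.
have [/eqP P0|P0] := boolP (P == [::]).
  by rewrite P0 left_sum_nil normr0 !mulr_ge0 ?addr_ge0 ?invr_ge0 ?powR_ge0// ltW.
have ab : a < b by apply: itv_partition_size_neq0 abP; rewrite lt0n size_eq0.
have ab1 := itv_partition1 ab.
have bP : subseq [:: b] P.
  by rewrite sub1seq; case: abP P0 => _ /eqP <-; case: (P) => //= p s _; rewrite mem_last.
have := left_sum_refine N0 c0 _ _ kS fH abP ab1 bP (lexx _) (d := 0).
rewrite lexx alpha0 addr0 subr0 powRr0 mulr1 => /(_ isT ea) h.
rewrite -[X in `|X|](subrK (left_sum k f a [:: b])).
apply: le_trans (ler_normD _ _) _; rewrite addrC mulrDl mul1r.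
apply: lerD; last by rewrite mulrCA.
rewrite left_sum_cons left_sum_nil addr0; apply: le_trans (norm_mul _ _) _.
have -> : N * c * (b - a) `^ (alpha - eta) =
    (N * (b - a) `^ (- eta)) * (c * (b - a) `^ alpha).
  rewrite powRD; last by apply/implyP => _; rewrite gt_eqF ?subr_gt0.
  by rewrite [_ `^ alpha * _]mulrC mulrACA.
apply: ler_pM => //; first by apply: kS.1; rewrite lexx.
by apply: fH; rewrite ?lexx.
Qed.

(** Both sums are close to the sum over a common refinement; for [d > 0] the factor D^d is a rate in
    the mesh. *)
Lemma left_sum_cauchy N eta alpha c d D a b k f P Q :
  0 <= N -> 0 <= c -> 0 <= d <= alpha -> eta + d < alpha ->
  singular_at N eta a b k -> holder_on alpha c a b f ->
  itv_partition a b P -> itv_partition a b Q -> mesh a P <= D -> mesh a Q <= D ->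
  `|left_sum k f a P - left_sum k f a Q| <=
    2 * ((alpha - eta - d)^-1 * (b - a) `^ (alpha - eta - d)) * D `^ d * (N * c).
Proof.
move=> N0 c0 d0 dalpha kS fH abP abQ mP mQ.
have [S [abS PS QS]] := common_refinement abP abQ.
have hP := left_sum_refine N0 c0 d0 dalpha kS fH abS abP PS mP.
have hQ := left_sum_refine N0 c0 d0 dalpha kS fH abS abQ QS mQ.
rewrite -(subrKA (left_sum k f a S)); apply: le_trans (ler_normD _ _) _.
by rewrite [X in X + _]distrC; apply: le_trans (lerD hP hQ) _; lra.
Qed.

End SingularSums.

(** * Kernel and covariance norms *)

Section Norms.
Context {R : realType} {V : normedModType R} {T : R}.
Implicit Types (eta alpha N : R) (K Q : R -> R -> V).
Local Open Scope ereal_scope.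

Lemma knorm1_ge0 eta K : (0 < T)%R -> 0 <= knorm1 T eta K.
Proof.
move=> T0; apply: le_trans (ereal_sup_ubound _); last first.
  by exists T, 0%R; do ?split; rewrite ?lexx ?ler01 //=; lra.
by rewrite lee_fin divr_ge0 ?powR_ge0.
Qed.

Lemma knorm2_ge0 eta K : (0 < T)%R -> 0 <= knorm2 T eta K.
Proof.
move=> T0; apply: le_trans (ereal_sup_ubound _); last first.
  by exists T, (T / 2)%R, 0%R, 0%R; do ?split; rewrite ?lexx ?ler01 //=; lra.
by rewrite lee_fin divr_ge0 ?mulr_ge0 ?powR_ge0.
Qed.

Lemma knorm3_ge0 eta K : (0 < T)%R -> 0 <= knorm3 T eta K.
Proof.
move=> T0; apply: le_trans (ereal_sup_ubound _); last first.
  by exists T, (T / 2)%R, 0%R, 0%R; do ?split; rewrite ?lexx ?ler01 //=; lra.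
by rewrite lee_fin divr_ge0 ?mulr_ge0 ?powR_ge0.
Qed.

Lemma knorm4_ge0 eta K : (0 < T)%R -> 0 <= knorm4 T eta K.
Proof.
move=> T0; apply: le_trans (ereal_sup_ubound _); last first.
  by exists T, (T / 2)%R, (T / 4)%R, 0%R, 0%R, 0%R; do ?split; rewrite ?lexx ?ler01 //=; lra.
by rewrite lee_fin divr_ge0 ?mulr_ge0 ?powR_ge0.
Qed.

Lemma kernel_norm_ge0 eta K : (0 < T)%R -> 0 <= kernel_norm T eta K.
Proof. by move=> T0; rewrite !adde_ge0 ?knorm1_ge0 ?knorm2_ge0 ?knorm3_ge0 ?knorm4_ge0. Qed.

Lemma qnorm10_ge0 alpha Q : (0 < T)%R -> 0 <= qnorm10 T alpha Q.
Proof.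
move=> T0; apply: le_trans (ereal_sup_ubound _); last first.
  by exists T, 0%R, 0%R; do ?split; rewrite ?lexx ?ler01 //=; lra.
by rewrite lee_fin divr_ge0 ?powR_ge0.
Qed.

Lemma qnorm01_ge0 alpha Q : (0 < T)%R -> 0 <= qnorm01 T alpha Q.
Proof.
move=> T0; apply: le_trans (ereal_sup_ubound _); last first.
  by exists 0%R, T, 0%R; do ?split; rewrite ?lexx ?ler01 //=; lra.
by rewrite lee_fin divr_ge0 ?powR_ge0.
Qed.

Lemma qnorm11_ge0 alpha Q : (0 < T)%R -> 0 <= qnorm11 T alpha Q.
Proof.
move=> T0; apply: le_trans (ereal_sup_ubound _); last first.
  by exists T, 0%R, T, 0%R; do ?split; rewrite ?lexx ?ler01 //=; lra.
by rewrite lee_fin divr_ge0 ?powR_ge0.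
Qed.

Lemma cov_norm_ge0 alpha Q : (0 < T)%R -> 0 <= cov_norm T alpha Q.
Proof. by move=> T0; rewrite !adde_ge0 ?qnorm10_ge0 ?qnorm01_ge0 ?qnorm11_ge0. Qed.

Lemma cov_norm_rect_incr alpha Q N : (0 < T)%R -> cov_norm T alpha Q <= N%:E ->
  (forall s t s' t', 0 <= s < t -> t <= T -> 0 <= s' < t' -> t' <= T ->
    `|rect_incr Q s s' t t'| <= N * (t - s) `^ alpha * (t' - s') `^ alpha)%R.
Proof.
move=> T0 QN s t s' t' st tT st' tT'.
have : qnorm11 T alpha Q <= N%:E.
  apply: le_trans QN; rewrite leeDr// adde_ge0 ?qnorm10_ge0 ?qnorm01_ge0//.
move=> h.
have : (`|rect_incr Q s s' t t'| / (`|t - s| * `|t' - s'|) `^ alpha)%:E <= N%:E.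
  by apply: le_trans h; apply: ereal_sup_ubound; exists t, s, t', s'.
have ts : (0 < t - s)%R by lra.
have ts' : (0 < t' - s')%R by lra.
rewrite lee_fin !gtr0_norm// powRM ?(ltW ts) ?(ltW ts')//.
by rewrite ler_pdivrMr ?mulr_gt0 ?powR_gt0// mulrA.
Qed.

(** Because [Q] vanishes on the axes, an increment in one variable is a rectangular increment with a
    side on an axis. The length of its other side is at most [T], so each one-parameter seminorm
    costs a factor T^zeta. *)
Lemma cov_norm_le zeta Q N : (0 < T)%R ->
  (forall s t s' t', 0 <= s < t -> t <= T -> 0 <= s' < t' -> t' <= T ->
    `|rect_incr Q s s' t t'| <= N * (t - s) `^ zeta * (t' - s') `^ zeta)%R ->
  (0 <= zeta)%R -> (0 <= N)%R ->
  (forall t, 0 <= t <= T -> Q t 0 = 0 /\ Q 0 t = 0)%R ->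
  cov_norm T zeta Q <= (N * (1 + 2 * T `^ zeta))%:E.
Proof.
move=> T0 QN z0 N0 Q0; have TT t : (0 < t <= T)%R -> (t `^ zeta <= T `^ zeta)%R.
  by move=> tT; apply: ge0_ler_powR; rewrite ?nnegrE; lra.
have -> : (N * (1 + 2 * T `^ zeta) = N * T `^ zeta + N * T `^ zeta + N)%R by ring.
rewrite 2!EFinD; apply: leeD; [apply: leeD|]; apply: ge_ereal_sup => ? /=.
- move=> [t [s [t' [st [tT [t'T ->]]]]]]; rewrite lee_fin.
  have ts : (0 < t - s)%R by lra.
  rewrite gtr0_norm// ler_pdivrMr ?powR_gt0//.
  have [->|t'0] := eqVneq t' 0%R.
    rewrite (Q0 t _).1 ?(Q0 s _).1 ?subr0 ?normr0; try lra.
    by rewrite !mulr_ge0 ?powR_ge0.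
  have t'_gt0 : (0 < t')%R by rewrite lt_neqAle eq_sym t'0; lra.
  have := QN s t 0%R t' st tT; rewrite lexx /= => /(_ t'_gt0).
  rewrite /rect_incr (Q0 t _).1 ?(Q0 s _).1 ?subr0 ?addr0; try lra.
  move=> h; apply: le_trans (h _) _; first lra.
  rewrite -!mulrA ler_wpM2l// mulrC ler_wpM2r ?powR_ge0// TT//; lra.
- move=> [t [t' [s' [tT [st' [t'T ->]]]]]]; rewrite lee_fin.
  have ts : (0 < t' - s')%R by lra.
  rewrite gtr0_norm// ler_pdivrMr ?powR_gt0//.
  have [->|t0] := eqVneq t 0%R.
    rewrite (Q0 t' _).2 ?(Q0 s' _).2 ?subr0 ?normr0; try lra.
    by rewrite !mulr_ge0 ?powR_ge0.
  have t_gt0 : (0 < t)%R by rewrite lt_neqAle eq_sym t0; lra.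
  have := QN 0%R t s' t'; rewrite lexx /= => /(_ t_gt0) h.
  move: h; rewrite /rect_incr (Q0 t' _).2 ?(Q0 s' _).2 ?subr0 ?addr0; try lra.
  move=> h; apply: le_trans (h _ _ _) _ => //; first lra.
  rewrite -!mulrA ler_wpM2l// ler_wpM2r ?powR_ge0// TT//; lra.
- move=> [t [s [t' [s' [st [tT [st' [t'T ->]]]]]]]]; rewrite lee_fin.
  have ts : (0 < t - s)%R by lra.
  have ts' : (0 < t' - s')%R by lra.
  rewrite !gtr0_norm// powRM ?(ltW ts) ?(ltW ts')//.
  by rewrite ler_pdivrMr ?mulr_gt0 ?powR_gt0// mulrA QN.
Qed.

End Norms.

(** The two hypotheses bound [B] by a multiple of min(1, x/y), and min(1, x/y) <= 2x / (x + y). This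
    is the form of the increment bound in [singular_at]. *)
Lemma two_bounds (R : realType) (B N y x p : R) : 0 < x -> 0 < y -> 0 <= N ->
  B <= N * y `^ p -> B <= N * (x * y `^ (p - 1)) ->
  B <= 2 * N * y `^ p * (x / (x + y)).
Proof.
move=> x0 y0 N0 B0 B1; set z := y `^ p; have z0 : 0 <= N * z by rewrite mulr_ge0 ?powR_ge0.
have [xy|yx] := leP x y.
  apply: le_trans B1 _.
  have -> : y `^ (p - 1) = z / y.
    by rewrite powRD ?powRN ?powRr1 ?ltW//; apply/implyP => _; rewrite gt_eqF.
  have -> : N * (x * (z / y)) = N * z * (x / y) by ring.
  have -> : 2 * N * z * (x / (x + y)) = N * z * (2 * (x / (x + y))) by ring.
  rewrite ler_wpM2l// mulrCA ler_wpM2l ?(ltW x0)//.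
  by rewrite ler_pdivlMr ?addr_gt0// mulrC ler_pdivrMr//; lra.
apply: le_trans B0 _.
have -> : 2 * N * z * (x / (x + y)) = N * z * (2 * (x / (x + y))) by ring.
rewrite ler_peMr// mulrA ler_pdivlMr ?addr_gt0//; lra.
Qed.

(** * Kernels at a fixed time as singular functions of one variable *)

Section Kernels.
Context {R : realType} {V : normedModType R} {T : R}.
Implicit Types (eta nu N s t : R) (K : R -> R -> V).

Lemma kernel_norm_knorms eta K N : 0 < T -> (kernel_norm T eta K <= N%:E)%E ->
  [/\ knorm1 T eta K <= N%:E, knorm2 T eta K <= N%:E,
      knorm3 T eta K <= N%:E & knorm4 T eta K <= N%:E]%E.
Proof.
move=> T0 KN.
have h1 := knorm1_ge0 eta K T0; have h2 := knorm2_ge0 eta K T0.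
have h3 := knorm3_ge0 eta K T0; have h4 := knorm4_ge0 eta K T0.
rewrite /kernel_norm in KN.
split; apply: le_trans KN.
- by rewrite -!addeA leeDl ?adde_ge0.
- by rewrite -!addeA addeCA leeDl ?adde_ge0.
- by rewrite addeAC leeDr ?adde_ge0.
- by rewrite leeDr ?adde_ge0.
Qed.

Lemma kernel_norm_bound_ge0 eta K N : 0 < T -> (kernel_norm T eta K <= N%:E)%E -> 0 <= N.
Proof. by move=> T0 /(le_trans (kernel_norm_ge0 eta K T0)); rewrite lee_fin. Qed.

(** The two inputs of [two_bounds] are [knorm3] at theta = 0 and at theta = 1, with x = u - r and y
    = t - u. *)
Lemma kernel_singular_at eta K N s t : 0 < T -> 0 <= s -> t <= T ->
  (kernel_norm T eta K <= N%:E)%E -> singular_at (2 * N) eta s t (K t).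
Proof.
move=> T0 s0 tT KN; have N0 := kernel_norm_bound_ge0 T0 KN.
have [K1 _ K3 _] := kernel_norm_knorms T0 KN; split=> [r rt|r u ru ut].
  have : ((`|K t r| / `|t - r| `^ (- eta))%:E <= N%:E)%E.
    apply: le_trans K1; apply: ereal_sup_ubound; exists t, r; do ?split => //.
    by lra.
  have tr : 0 < t - r by lra.
  rewrite lee_fin gtr0_norm// ler_pdivrMr ?powR_gt0// => h.
  by apply: le_trans h _; rewrite ler_wpM2r ?powR_ge0//; lra.
have tu : 0 < t - u by lra.
have ur : 0 < u - r by lra.
have K3t theta : 0 <= theta <= 1 ->
    `|K t u - K t r| <= N * ((u - r) `^ theta * (t - u) `^ (- theta - eta)).
  move=> th; have : ((`|K t u - K t r| /
      (`|u - r| `^ theta * `|t - u| `^ (- theta - eta)))%:E <= N%:E)%E.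
    apply: le_trans K3; apply: ereal_sup_ubound.
    by exists t, u, r, theta; do ?split => //; lra.
  by rewrite lee_fin !gtr0_norm// ler_pdivrMr// mulr_gt0 ?powR_gt0.
have -> : t - r = u - r + (t - u) by lra.
apply: two_bounds => //.
  by have := K3t 0; rewrite powRr0 mul1r oppr0 sub0r; apply; lra.
have -> : - eta - 1 = - 1 - eta by ring.
by have := K3t 1; rewrite powRr1 ?(ltW ur)//; apply; lra.
Qed.

(** For fixed [nu], the seminorms [knorm2] and [knorm4] say of [K t - K s] what [knorm1] and
    [knorm3] say of a kernel: the singularity moves to [s], its exponent grows by [nu], and in
    exchange the factor (t - s)^nu is gained. *)
Lemma kernel_diff_singular_at eta nu K N s t : 0 < T -> 0 <= nu <= 1 ->
  s < t -> t <= T -> (kernel_norm T eta K <= N%:E)%E ->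
  singular_at (2 * (N * (t - s) `^ nu)) (eta + nu) 0 s (K t - K s).
Proof.
move=> T0 nu01 st tT KN; have N0 := kernel_norm_bound_ge0 T0 KN.
have [_ K2 _ K4] := kernel_norm_knorms T0 KN.
have ts : 0 < t - s by lra.
have Nnu : 0 <= N * (t - s) `^ nu by rewrite mulr_ge0 ?powR_ge0.
split=> [r rs|r u ru us]; rewrite !fctE.
  have : ((`|K t r - K s r| /
      (`|t - s| `^ nu * `|s - r| `^ (- nu - eta)))%:E <= N%:E)%E.
    apply: le_trans K2; apply: ereal_sup_ubound.
    by exists t, s, r, nu; do ?split => //; lra.
  have sr : 0 < s - r by lra.
  rewrite lee_fin !gtr0_norm// ler_pdivrMr ?mulr_gt0 ?powR_gt0// => h.
  apply: le_trans h _; rewrite !mulrA opprD (addrC (- eta)).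
  by rewrite ler_wpM2r ?powR_ge0//; lra.
have su : 0 < s - u by lra.
have ur : 0 < u - r by lra.
have K4t theta : 0 <= theta <= 1 -> `|K t u - K s u - (K t r - K s r)| <=
    N * (t - s) `^ nu * ((u - r) `^ theta * (s - u) `^ (- nu - theta - eta)).
  move=> th; have : ((`|K t u - K t r - K s u + K s r| /
      (`|s - u| `^ (- nu - theta - eta) * `|t - s| `^ nu * `|u - r| `^ theta))%:E
      <= N%:E)%E.
    apply: le_trans K4; apply: ereal_sup_ubound.
    by exists t, s, u, r, theta, nu; do ?split => //; lra.
  have -> : K t u - K s u - (K t r - K s r) = K t u - K t r - K s u + K s r.
    by rewrite opprB addrA addrAC; congr (_ + _); rewrite addrAC.
  rewrite lee_fin !gtr0_norm// ler_pdivrMr ?mulr_gt0 ?powR_gt0//.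
  by move=> h; apply: le_trans h _; rewrite le_eqVlt; apply/orP; left; apply/eqP; ring.
have -> : s - r = u - r + (s - u) by lra.
apply: two_bounds => //.
  have := K4t 0; rewrite powRr0 mul1r.
  by have -> : - nu - 0 - eta = - (eta + nu) by [ring]; apply; lra.
have := K4t 1; rewrite powRr1 ?(ltW ur)//.
by have -> : - nu - 1 - eta = - (eta + nu) - 1 by [ring]; apply; lra.
Qed.

End Kernels.

(** * Functionals on Hoelder functions *)

Section HolderFunctionals.
Context {R : realType} {E : normedModType R} (alpha T : R).
Implicit Types (Phi Psi : (R -> E) -> E) (Q : R -> R -> E) (f g : R -> E).

(** Of linearity only compatibility with differences is kept. [C] bounds the norm of [Phi] with
    respect to the Hoelder seminorm on [0, T]. *)
Definition holder_functional C Phi :=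
  (forall f g, Phi (f - g) = Phi f - Phi g) /\
  (forall c f, 0 <= c -> holder_on alpha c 0 T f -> `|Phi f| <= C * c).

Definition rect_holder q Q := forall s t s' t',
  0 <= s < t -> t <= T -> 0 <= s' < t' -> t' <= T ->
  `|rect_incr Q s s' t t'| <= q * (t - s) `^ alpha * (t' - s') `^ alpha.

(** The increment of r' |-> [Phi (Q ^~ r')] is [Phi] of an increment of [Q] in the second variable,
    which is Hoelder in the first one with constant q (v' - u')^alpha. Hence the function fed to
    [Psi] is Hoelder with constant [A * q]. *)
Lemma holder_functional_tensor A B q Phi Psi Q :
  holder_functional A Phi -> holder_functional B Psi -> 0 <= A -> 0 <= q ->
  rect_holder q Q -> `|Psi (fun r' => Phi (Q ^~ r'))| <= B * (A * q).
Proof.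
move=> [PhiB PhiA] [_ PsiB] A0 q0 Qq; apply: PsiB; first exact: mulr_ge0.
move=> u' v' uv' vT'; rewrite -PhiB -mulrA; apply: PhiA.
  by rewrite mulr_ge0 ?powR_ge0.
move=> u v uv vT; rewrite mulrAC !fctE.
have -> : Q v v' - Q v u' - (Q u v' - Q u u') = rect_incr Q u u' v v'.
  by rewrite /rect_incr opprB addrA addrAC.
exact: Qq.
Qed.

(** Telescoping: [Psi], then [Phi], then [Q] is exchanged, and each of the three differences is an
    instance of [holder_functional_tensor]. *)
Lemma holder_functional_tensor_diff A A' B B' q q' Phi Phit Psi Psit Q Qt :
  holder_functional A Phi -> holder_functional A Phit ->
  holder_functional B Psit ->
  holder_functional A' (fun f => Phi f - Phit f) ->
  holder_functional B' (fun f => Psi f - Psit f) ->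
  0 <= A -> 0 <= A' -> 0 <= q -> 0 <= q' ->
  rect_holder q Q -> rect_holder q' (Q - Qt) ->
  `|Psi (fun r' => Phi (Q ^~ r')) - Psit (fun r' => Phit (Qt ^~ r'))| <=
    B' * (A * q) + B * (A' * q) + B * (A * q').
Proof.
move=> hPhi hPhit hPsit hPhiB hPsiB A0 A'0 q0 q'0 hQ hQB.
have -> : Psi (fun r' => Phi (Q ^~ r')) - Psit (fun r' => Phit (Qt ^~ r')) =
    (Psi (fun r' => Phi (Q ^~ r')) - Psit (fun r' => Phi (Q ^~ r')))
    + Psit (fun r' => Phi (Q ^~ r') - Phit (Q ^~ r'))
    + Psit (fun r' => Phit ((Q - Qt) ^~ r')).
  have -> : (fun r' => Phi (Q ^~ r') - Phit (Q ^~ r')) =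
    (fun r' => Phi (Q ^~ r')) - (fun r' => Phit (Q ^~ r')) by [].
  have -> : (fun r' => Phit ((Q - Qt) ^~ r')) =
      (fun r' => Phit (Q ^~ r')) - (fun r' => Phit (Qt ^~ r')).
    by apply/funext => r'; rewrite !fctE -hPhit.1.
  by rewrite !hPsit.1 !subrKA.
apply: le_trans (ler_normD _ _) (lerD (le_trans (ler_normD _ _) (lerD _ _)) _).
- exact: (holder_functional_tensor hPhi hPsiB).
- exact: (holder_functional_tensor hPhiB hPsit).
- exact: (holder_functional_tensor hPhit hPsit).
Qed.

End HolderFunctionals.

(** * One-parameter sums of a kernel and their increments in time *)

Section VolterraSums.
Context {R : realType} {F E : normedModType R}.
Context (mul : F -> E -> E).
Hypothesis mulBl : forall x y z, mul (x - y) z = mul x z - mul y z.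
Hypothesis mulBr : forall x y z, mul x (y - z) = mul x y - mul x z.
Hypothesis norm_mul : forall x y, `|mul x y| <= `|x| * `|y|.
Implicit Types (K : R -> R -> F) (f : R -> E).

(** The partition of [0, t] passes through [s] and extends the one of [0, s], so that on [0, s] the
    two sums differ only by the kernel. *)
Definition left_sum_incr K s t Ps Pt f :=
  left_sum mul (K t) f 0 (Ps ++ Pt) - left_sum mul (K s) f 0 Ps.

Lemma left_sum_incrB K Kt s t Ps Pt f :
  left_sum_incr K s t Ps Pt f - left_sum_incr Kt s t Ps Pt f =
  left_sum_incr (K - Kt) s t Ps Pt f.
Proof.
by rewrite /left_sum_incr !fctE !left_sumBl// opprD addrACA -opprD.
Qed.

Context (T eta alpha N : R) (K : R -> R -> F).
Hypothesis T_gt0 : 0 < T.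
Hypothesis eta_ge0 : 0 <= eta.
Hypothesis KN : (kernel_norm T eta K <= N%:E)%E.

Lemma holder_on_sub a b c f : 0 <= a -> b <= T ->
  holder_on alpha c 0 T f -> holder_on alpha c a b f.
Proof.
by move=> a0 bT fc u v uv vb; apply: fc; move: uv; lra.
Qed.

Lemma left_sum_functional t P : eta < alpha -> 0 <= t <= T -> itv_partition 0 t P ->
  holder_functional alpha T
    ((1 + (alpha - eta)^-1) * (2 * N * t `^ (alpha - eta)))
    (fun f => left_sum mul (K t) f 0 P).
Proof.
move=> ea /andP[t0 tT] tP; have := kernel_norm_bound_ge0 T_gt0 KN => N0.
have e0 := eta_ge0.
split=> [f g|c f c0 fc]; first exact: left_sumBr.
have -> : (1 + (alpha - eta)^-1) * (2 * N * t `^ (alpha - eta)) * c =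
    (1 + (alpha - eta)^-1) * (2 * N * c * (t - 0) `^ (alpha - eta)).
  by rewrite subr0; ring.
apply: (left_sum_bound mulBl) tP => //; try lra.
  exact: kernel_singular_at KN.
exact: holder_on_sub fc.
Qed.

Lemma left_sum_cauchy_functional d D t P Q :
  0 <= d <= alpha -> eta + d < alpha -> 0 <= t <= T ->
  itv_partition 0 t P -> itv_partition 0 t Q -> mesh 0 P <= D -> mesh 0 Q <= D ->
  holder_functional alpha T
    (2 * ((alpha - eta - d)^-1 * t `^ (alpha - eta - d)) * D `^ d * (2 * N))
    (fun f => left_sum mul (K t) f 0 P - left_sum mul (K t) f 0 Q).
Proof.
move=> hd ed /andP[t0 tT] tP tQ mP mQ; have := kernel_norm_bound_ge0 T_gt0 KN => N0.
split=> [f g|c f c0 fc].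
  by rewrite !left_sumBr// !opprD !opprK addrACA.
rewrite -(mulrA _ _ c); have -> : t `^ (alpha - eta - d) = (t - 0) `^ (alpha - eta - d).
  by rewrite subr0.
apply: (left_sum_cauchy mulBl mulBr norm_mul) tP tQ mP mQ => //; try lra.
  exact: kernel_singular_at KN.
exact: holder_on_sub fc.
Qed.

(** On [0, s] the kernel [K t - K s] is used with exponent [eta + zeta], which yields (t - s)^zeta
    directly. On [s, t] the bound (t - s)^(alpha - eta) is split into (t - s)^zeta and a power at
    most that of [T]. Both parts fit under the same constant, whence 4 = 2 + 2. *)
Lemma left_sum_incr_functional zeta s t Ps Pt :
  0 <= zeta <= 1 -> eta + zeta < alpha -> 0 <= s < t -> t <= T ->
  itv_partition 0 s Ps -> itv_partition s t Pt ->
  holder_functional alpha T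
    (4 * (1 + (alpha - (eta + zeta))^-1) * T `^ (alpha - (eta + zeta))
     * N * (t - s) `^ zeta)
    (left_sum_incr K s t Ps Pt).
Proof.
move=> z01 ez /andP[s0 st] tT sP tP; have N0 := kernel_norm_bound_ge0 T_gt0 KN.
have e0 := eta_ge0; have T0 := T_gt0.
split=> [f g|c f c0 fc].
  by rewrite /left_sum_incr !left_sumBr// !opprD !opprK addrACA.
have -> : left_sum_incr K s t Ps Pt f =
    left_sum mul (K t - K s) f 0 Ps + left_sum mul (K t) f s Pt.
  by rewrite /left_sum_incr (left_sum_cat _ _ _ _ sP) left_sumBl// addrAC.
apply: le_trans (ler_normD _ _) _.
set kap := alpha - (eta + zeta); have k0 : 0 < kap by rewrite /kap; lra.
have ts0 : 0 < t - s by lra.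
have h1 : `|left_sum mul (K t - K s) f 0 Ps| <=
    (1 + kap^-1) * (2 * (N * (t - s) `^ zeta) * c * (s - 0) `^ kap).
  apply: (left_sum_bound mulBl) sP => //; rewrite ?mulr_ge0 ?powR_ge0//; try lra.
    exact: kernel_diff_singular_at KN.
  by apply: holder_on_sub fc => //; lra.
have h2 : `|left_sum mul (K t) f s Pt| <=
    (1 + (alpha - eta)^-1) * (2 * N * c * (t - s) `^ (alpha - eta)).
  apply: (left_sum_bound mulBl) tP => //; rewrite ?mulr_ge0//; try lra.
    exact: kernel_singular_at KN.
  exact: holder_on_sub fc.
have {}h1 : `|left_sum mul (K t - K s) f 0 Ps| <=
    2 * (1 + kap^-1) * T `^ kap * N * (t - s) `^ zeta * c.
  apply: le_trans h1 _.
  have -> : 2 * (1 + kap^-1) * T `^ kap * N * (t - s) `^ zeta * c =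
     (1 + kap^-1) * (2 * (N * (t - s) `^ zeta) * c * T `^ kap) by ring.
  rewrite !ler_wpM2l ?mulr_ge0 ?addr_ge0 ?invr_ge0 ?powR_ge0 ?(ltW k0)//.
  by apply: ge0_ler_powR; rewrite ?nnegrE; lra.
have {}h2 : `|left_sum mul (K t) f s Pt| <=
    2 * (1 + kap^-1) * T `^ kap * N * (t - s) `^ zeta * c.
  apply: le_trans h2 _.
  have -> : 2 * (1 + kap^-1) * T `^ kap * N * (t - s) `^ zeta * c =
     (1 + kap^-1) * (2 * N * c * (T `^ kap * (t - s) `^ zeta)) by ring.
  have ka : kap <= alpha - eta by rewrite /kap; lra.
  apply: ler_pM; rewrite ?mulr_ge0 ?addr_ge0 ?invr_ge0 ?powR_ge0//; first lra.
    by rewrite lerD2l lef_pV2// posrE; lra.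
  rewrite ler_wpM2l ?mulr_ge0//.
  have -> : alpha - eta = kap + zeta by rewrite /kap; lra.
  rewrite powRD; last by apply/implyP => _; rewrite gt_eqF.
  rewrite ler_wpM2r ?powR_ge0//.
  by apply: ge0_ler_powR; rewrite ?nnegrE; lra.
apply: le_trans (lerD h1 h2) _; rewrite -/kap; lra.
Qed.

End VolterraSums.

(** * Adjoints and completeness *)

Section Adjoint.
Context {R : realType} {H : completeNormedModType R} (dot : {dot H for idfun}).
Hypothesis dot_norm : forall x : H, `|x| ^+ 2 = dot x x.
Implicit Types x y z : H.

Lemma dotC x y : dot x y = dot y x.
Proof. by rewrite hermC expr0 mul1r. Qed.

Lemma dotBl x y z : dot (x - y) z = dot x z - dot y z.
Proof. exact: linearBl. Qed.

Lemma dotBr x y z : dot z (x - y) = dot z x - dot z y.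
Proof. exact: linearBr. Qed.

Lemma dot_norm_add x y (h : R) :
  `|x + h *: y| ^+ 2 = `|x| ^+ 2 + 2 * h * dot x y + h ^+ 2 * `|y| ^+ 2.
Proof.
rewrite !dot_norm !linearDl !linearDr linearZl_LR /= !linearZr_LR /=.
rewrite (dotC y x) linearZl_LR /=; ring.
Qed.

(** Tested at h = - B / (A + 1), whose denominator is positive even for A = 0, the expression is a
    negative multiple of B^2. *)
Lemma quadratic_le0 (A B : R) : (forall h, 0 <= 2 * h * B + h ^+ 2 * A) -> B = 0.
Proof.
move=> hAB.
have A0 : 0 <= A by have := hAB 1; have := hAB (-1); lra.
have := hAB (- B / (A + 1)).
have -> : 2 * (- B / (A + 1)) * B + (- B / (A + 1)) ^+ 2 * A =
   - (B ^+ 2 * ((A + 2) / (A + 1) ^+ 2)) by field; lra.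
rewrite oppr_ge0 pmulr_lle0; last by rewrite divr_gt0 ?exprn_gt0//; lra.
by rewrite le_eqVlt ltNge sqr_ge0 orbF sqrf_eq0 => /eqP.
Qed.

Lemma dot_eq0 y : (forall x, dot x y = 0) -> y = 0.
Proof. by move=> y0; apply/normr0_eq0/eqP; rewrite -sqrf_eq0 dot_norm y0. Qed.

(** The square of |x + h y| is nonnegative at its minimiser h = - [dot x y] / |y|^2. *)
Lemma dot_cauchy_schwarz x y : `|dot x y| <= `|x| * `|y|.
Proof.
have [->|y0] := eqVneq y 0; first by rewrite linear0r normr0 mulr_ge0.
have ny : 0 < `|y| ^+ 2 by rewrite exprn_gt0 ?normr_gt0.
have := sqr_ge0 `|x + (- dot x y / `|y| ^+ 2) *: y|.
rewrite dot_norm_add.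
have -> : `|x| ^+ 2 + 2 * (- dot x y / `|y| ^+ 2) * dot x y +
   (- dot x y / `|y| ^+ 2) ^+ 2 * `|y| ^+ 2 =
   `|x| ^+ 2 - dot x y ^+ 2 / `|y| ^+ 2 by field; rewrite ?gt_eqF ?normr_gt0.
rewrite subr_ge0 ler_pdivrMr// -exprMn -(real_normK (num_real (dot x y))) => h.
by rewrite -(@ler_pXn2r _ 2) ?nnegrE ?mulr_ge0.
Qed.

(* Riesz: a minimising sequence of |x|^2 - 2 f(x) is Cauchy, by the
   parallelogram identity, and its limit represents f. *)
Lemma riesz_representation (f : {scalar H}) (C : R) :
  (forall x, `|f x| <= C * `|x|) -> exists y, forall x, f x = dot x y.
Proof.
move=> fC; pose q x := `|x| ^+ 2 - 2 * f x.
have q_ge x : - C ^+ 2 <= q x.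
  have := sqr_ge0 (`|x| - C); have := fC x; rewrite ler_norml /q.
  by move=> /andP[_ h]; nra.
pose S := range q; pose m := inf S.
have hS : has_inf S.
  by split; [exists (q 0), 0|exists (- C ^+ 2) => _ [x _ <-]].
have m_le x : m <= q x by apply: ge_inf; [case: hS|exists x].
have /choice[u uP] n : exists x, q x < m + n.+1%:R^-1.
  have e0 : 0 < (n.+1%:R : R)^-1 by rewrite invr_gt0 ltr0n.
  by have [_ [x _ <-]] := inf_adherent e0 hS; exists x.
have par x y : `|x - y| ^+ 2 <= 2 * (q x - m) + 2 * (q y - m).
  have fxy : f (2^-1 *: (x + y)) = 2^-1 * (f x + f y) by rewrite linearZ /= linearD.
  have := m_le (2^-1 *: (x + y)); rewrite /q fxy normrZ exprMn.
  rewrite ger0_norm ?invr_ge0//.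
  have := dot_norm_add x y 1; have := dot_norm_add x y (-1).
  by rewrite !scale1r scaleN1r; lra.
have u_cauchy : cauchy (u @ \oo).
  apply: cauchy_exP => e e0.
  have e2 : 0 < e ^+ 2 / 4 by rewrite divr_gt0 ?exprn_gt0.
  have [n _ nP] : \forall n \near \oo, (n.+1%:R : R)^-1 < e ^+ 2 / 4.
    by have := near_infty_natSinv_lt (PosNum e2).
  exists (u n); exists n => // k /= nk.
  rewrite -ball_normE /ball_ /=.
  rewrite -(@ltr_pXn2r _ 2) ?nnegrE ?(ltW e0)//.
  apply: le_lt_trans (par _ _) _.
  have := uP n; have := uP k; have := nP n (leqnn n); have := nP k nk; rewrite /=.
  by move: (k.+1%:R^-1) (n.+1%:R^-1) => *; lra.
have /cauchy_cvgP u_cvg := u_cauchy.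
exists (lim (u @ \oo)) => x; set y := lim _.
apply/eqP; rewrite -subr_eq0; apply/eqP.
(* First variation: comparing [q] near the minimiser along the direction [x] gives a quadratic in
   [h] that is nonnegative. The comparison is made at [u n], and the error [e] is then sent to 0. *)
apply: (@quadratic_le0 (`|x| ^+ 2)) => h.
suff sq (e : R) : 0 < e -> 0 <= 2 * h * (f x - dot x y) + h ^+ 2 * `|x| ^+ 2 + e.
  by apply/ler_addgt0Pr => e; exact: sq.
move=> e0.
(* With this tolerance on |y - u n|, replacing [y] by [u n] changes the linear term by at most e /
   2; the other e / 2 absorbs the defect of minimality. *)
have x0 : 0 < 2 * `|h| * `|x| + 1 by rewrite ltr_wpDl// !mulr_ge0.
have d0 : 0 < e / 2 / (2 * `|h| * `|x| + 1) by rewrite !divr_gt0.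
have /cvgrPdist_lt/(_ _ d0) uy := u_cvg.
have ne : \forall n \near \oo, (n.+1%:R : R)^-1 < e / 2.
  by have e2 : 0 < e / 2 by [rewrite divr_gt0]; have := near_infty_natSinv_lt (PosNum e2).
near \oo => n.
have un : `|y - u n| < e / 2 / (2 * `|h| * `|x| + 1) by near: n.
have ne2 : (n.+1%:R : R)^-1 < e / 2 by near: n.
have fE : f (u n + (- h) *: x) = f (u n) - h * f x.
  by rewrite linearD linearZ /= mulNr.
have := m_le (u n + (- h) *: x); have := uP n.
rewrite /q fE dot_norm_add sqrrN => qn mq.
have small (a b c : R) : a * (2 * b * c + 1) < e / 2 -> 0 <= a -> b * (a * c) <= e / 4.
  by lra.
have hw : `|h * (dot y x - dot (u n) x)| <= e / 4.
  rewrite -linearBl normrM.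
  apply: le_trans (ler_wpM2l (normr_ge0 _) (dot_cauchy_schwarz _ _)) _.
  have := normr_ge0 (y - u n); move: un; rewrite ltr_pdivlMr//.
  exact: small.
move: hw; rewrite ler_norml (dotC x y) => /andP[_ hw].
move: qn mq ne2 hw; move: (n.+1%:R^-1) => r; lra.
Unshelve. all: by end_near. Qed.

(** Riesz is applied for each [y] to x |-> [dot (A x) y]. Nondegeneracy of [dot] forces the
    resulting map [B] to be linear, and |B y|^2 = [dot (A (B y)) y] bounds it. *)
Lemma adjoint_exists (A : 'L(H)) :
  exists B : 'L(H), forall x y, dot (A x) y = dot x (B y).
Proof.
have dotA y : exists z, forall x, dot (A x) y = dot x z.
  have lin : GRing.linear_for *%R (fun x => dot (A x) y).
    by move=> a u v; rewrite linearP linearDl linearZl_LR.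
  pose f := GRing.isLinear.Build _ _ _ _ _ lin.
  pose g : {scalar H} := HB.pack (fun x => dot (A x) y) f.
  apply: (@riesz_representation g (opnorm A * `|y|)) => x.
  apply: le_trans (dot_cauchy_schwarz _ _) _.
  by rewrite mulrAC ler_wpM2r// opnormP.
have [B BP] := choice dotA.
have lB : linear B.
  move=> a u v; apply/eqP; rewrite -subr_eq0; apply/eqP/dot_eq0 => x.
  by rewrite linearBr linearDr linearZr_LR /= -!BP linearDr linearZr_LR /= subrr.
have bB y : `|B y| <= opnorm A * `|y|.
  have [->|B0] := eqVneq (B y) 0; first by rewrite normr0 mulr_ge0 ?opnorm_ge0.
  rewrite -(@ler_pM2l _ `|B y|) ?normr_gt0// -expr2 dot_norm -BP.
  apply: le_trans (ler_norm _) (le_trans (dot_cauchy_schwarz _ _) _).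
  by rewrite mulrA [_ * opnorm A]mulrC ler_wpM2r// opnormP.
have Bb : B \in bounded_op by apply/asboolP; split=> //; exists (opnorm A).
by exists (Bop Bb) => x y /=.
Qed.

Lemma adjointP (A : 'L(H)) x y : dot (A x) y = dot x (adjoint dot A y).
Proof. by move: x y; exact: (getPex (adjoint_exists A)). Qed.

Lemma adjointB (A B : 'L(H)) : adjoint dot (A - B) = adjoint dot A - adjoint dot B.
Proof.
apply/val_inj/funext => y.
rewrite -[LHS]/(adjoint dot (A - B) y) -[RHS]/(adjoint dot A y - adjoint dot B y).
apply/eqP; rewrite -subr_eq0; apply/eqP/dot_eq0 => x.
rewrite !dotBr -!adjointP [(A - B) x](_ : _ = A x - B x)//.
by rewrite dotBl subrr.
Qed.

Lemma norm_adjoint (A : 'L(H)) : `|adjoint dot A| <= `|A|.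
Proof.
apply: opnorm_le => y y1.
have [->|B0] := eqVneq (adjoint dot A y) 0; first by rewrite normr0 opnorm_ge0.
rewrite -(@ler_pM2l _ `|adjoint dot A y|) ?normr_gt0// -expr2 dot_norm -adjointP.
apply: le_trans (ler_norm _) (le_trans (dot_cauchy_schwarz _ _) _).
apply: le_trans (ler_wpM2l _ y1) _ => //; rewrite mulr1 mulrC.
exact: opnormP.
Qed.

End Adjoint.

Lemma norm_bopB_le (R : realType) (V : normedModType R) (A B : 'L(V)) x :
  `|A x - B x| <= `|A - B| * `|x|.
Proof. exact: (opnormP (A - B)). Qed.

(** The limit [g] is taken pointwise, by completeness of [H]. The Cauchy bound passes to the limit
    at each point with a constant proportional to |x|, so [g] is bounded and the convergence is in
    operator norm. *)
Lemma bop_cauchy_cvg (R : realType) (H : completeNormedModType R)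
  (F : set_system 'L(H)) : ProperFilter F -> cauchy F -> cvg F.
Proof.
move=> FF /cauchyP Fc.
have pt x : cvg ((fun A : 'L(H) => A x) @ F).
  apply: cauchy_cvg; apply: cauchy_exP => e e0.
  have d0 : 0 < e / (`|x| + 1) by rewrite divr_gt0// ltr_wpDl.
  have [A FA] := Fc _ d0; exists (A x).
  rewrite -[X in X _]/(F \o (preimage (fun A : 'L(H) => A x))) /=.
  apply: filterS FA => B /=; rewrite -!ball_normE /= => AB.
  apply: le_lt_trans (norm_bopB_le A B x) _.
  rewrite ltr_pdivlMr ?ltr_wpDl// in AB; apply: le_lt_trans AB.
  by rewrite ler_wpM2l// lerDl.
pose g x := lim ((fun A : 'L(H) => A x) @ F).
have lg : linear g.
  move=> a x y; apply: cvg_lim => //.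
  rewrite (_ : (fun A : 'L(H) => A (a *: x + y)) = (fun A => a *: A x + A y)).
    by apply: cvgD; [apply: cvgZr; exact: pt|exact: pt].
  by apply/funext => A; rewrite linearP.
have gd (e : R) : 0 < e -> exists2 A : 'L(H), F (ball A e) &
    forall x, `|A x - g x| <= e * `|x|.
  move=> e0; have [A FA] := Fc _ e0; exists A => // x.
  have : (fun B : 'L(H) => `|A x - B x|) @ F --> `|A x - g x|.
    by apply: cvg_norm; apply: cvgB; [exact: cvg_cst|exact: pt].
  move/cvgr_to_le; apply; apply: filterS FA => B; rewrite -!ball_normE /= => AB.
  apply: le_trans (norm_bopB_le A B x) _.
  by rewrite ler_wpM2r// ltW.
have bg : g \in bounded_op.
  apply/asboolP; split=> //; have [A _ Ag] := gd 1 ltr01.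
  exists (opnorm A + 1) => x; rewrite mulrDl.
  rewrite -[g x](subrK (A x)) addrC; apply: le_trans (ler_normD _ _) _.
  by rewrite lerD ?opnormP// distrC.
apply/cvg_ex; exists (Bop bg); apply/cvgrPdist_le => e e0 /=.
have e2 : 0 < e / 2 by rewrite divr_gt0.
have [A FA Ag] := gd _ e2.
apply: filterS FA => B; rewrite -!ball_normE /= => AB.
rewrite -(subrKA A); apply: le_trans (ler_normD _ _) _.
rewrite [e]splitr; apply: lerD; last exact: ltW.
apply: opnorm_le => x x1; rewrite -normrN opprB.
apply: le_trans (Ag x) _; rewrite -[leRHS]mulr1 ler_wpM2l// ltW//.
Qed.

(** * Double integrals *)

Lemma rect_incrB (R : realType) (V : normedModType R) (f g : R -> R -> V) s s' t t' :
  rect_incr (f - g) s s' t t' = rect_incr f s s' t t' - rect_incr g s s' t t'.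
Proof.
have swap (x y z w : V) : (x - y) - (z - w) = (x - z) - (y - w).
  by rewrite opprD addrACA -opprD.
have -> : rect_incr (f - g) s s' t t' = (f t t' - g t t') - (f t s' - g t s')
    - (f s t' - g s t') + (f s s' - g s s') by [].
by rewrite (swap (f t t')) (swap (f t t' - f t s')) addrACA -opprD.
Qed.

Section BopComp.
Context {R : realType} {V : normedModType R}.
Implicit Types A B C : 'L(V).

Lemma bop_compBl A B C : (A - B) \oL C = A \oL C - B \oL C.
Proof. exact/val_inj. Qed.

Lemma bop_compBr A B C : A \oL (B - C) = A \oL B - A \oL C.
Proof. by apply/val_inj/funext => x; exact: (linearB A). Qed.

Lemma bop_comp_suml I (r : seq I) (F : I -> 'L(V)) C :
  (\sum_(i <- r) F i) \oL C = \sum_(i <- r) F i \oL C.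
Proof.
by apply: (big_morph (fun A => A \oL C)) => [A B|]; exact/val_inj.
Qed.

Lemma norm_bop_comp A B : `|A \oL B| <= `|A| * `|B|.
Proof.
apply: opnorm_le => x x1; apply: le_trans (opnormP A _) _.
by rewrite ler_wpM2l ?opnorm_ge0// opnorm_ge.
Qed.

End BopComp.

Lemma powR_small (R : realType) (C e d : R) : 0 <= C -> 0 < e -> 0 < d ->
  exists2 D, 0 < D & C * D `^ d <= e.
Proof.
move=> C0 e0 d0; have C1 : 0 < C + 1 by rewrite ltr_wpDl.
exists ((e / (C + 1)) `^ d^-1); first by apply: powR_gt0; rewrite divr_gt0.
rewrite -powRrM mulVf ?gt_eqF// powRr1 ?divr_ge0 ?(ltW e0) ?(ltW C1)//.
by rewrite mulrA ler_pdivrMr// mulrC ler_pM2l//; lra.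
Qed.

Section DoubleIntegrals.
Context {R : realType} {H : completeNormedModType R} (dot : {dot H for idfun}).
Hypothesis dot_norm : forall x : H, `|x| ^+ 2 = dot x x.
Implicit Types (K Q : R -> R -> 'L(H)) (A B : 'L(H)).

(** The kernel value comes first, as [left_sum] expects, although it acts from the right. *)
Definition adj_mul A B : 'L(H) := B \oL adjoint dot A.

Lemma adj_mulBl A B C : adj_mul (A - B) C = adj_mul A C - adj_mul B C.
Proof. by rewrite /adj_mul adjointB// bop_compBr. Qed.

Lemma adj_mulBr A B C : adj_mul A (B - C) = adj_mul A B - adj_mul A C.
Proof. exact: bop_compBl. Qed.

Lemma norm_adj_mul A B : `|adj_mul A B| <= `|A| * `|B|.
Proof.
by rewrite mulrC (le_trans (norm_bop_comp _ _))// ler_wpM2l// norm_adjoint.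
Qed.

(** This turns the double sum into a composition of two one-parameter sums, to which the bounds on
    Hoelder functionals apply. *)
Lemma double_sumE K Q t t' P P' : double_sum dot K Q t t' P P' =
  left_sum adj_mul (K t')
    (fun r' => left_sum (@bop_comp R H) (K t) (Q ^~ r') 0 P) 0 P'.
Proof.
rewrite /double_sum exchange_big; apply: eq_bigr => p' _.
rewrite -left_sumBr; last exact: bop_compBr.
rewrite /adj_mul bop_comp_suml; apply: eq_bigr => p _; rewrite !fctE.
by rewrite /rect_incr opprB addrA addrAC.
Qed.

Lemma double_sum_nil K Q t t' P P' : P = [::] \/ P' = [::] ->
  double_sum dot K Q t t' P P' = 0.
Proof.
case=> ->; rewrite /double_sum /subitvs /=; first exact: big_nil.
by apply: big1 => p _; exact: big_nil.
Qed.

Section Estimates.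
Context (T eta alpha : R).
Hypothesis T_gt0 : 0 < T.
Hypothesis eta_ge0 : 0 <= eta.
Hypothesis eta_alpha : eta < alpha.

(** * Convergence of the double sums and approximation of increments *)

Section Convergence.
Context (M : R) (K Q : R -> R -> 'L(H)).
Hypothesis KM : (kernel_norm T eta K <= M%:E)%E.
Hypothesis QM : (cov_norm T alpha Q <= M%:E)%E.

Lemma double_sum_cauchy t t' e : 0 <= t <= T -> 0 <= t' <= T -> 0 < e ->
  exists2 D, 0 < D & forall P S P' S',
    itv_partition 0 t P -> itv_partition 0 t S ->
    itv_partition 0 t' P' -> itv_partition 0 t' S' ->
    mesh 0 P < D -> mesh 0 S < D -> mesh 0 P' < D -> mesh 0 S' < D ->
    `|double_sum dot K Q t t' P P' - double_sum dot K Q t t' S S'| < e.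
Proof.
move=> tT t'T e0; have := kernel_norm_bound_ge0 T_gt0 KM => M0.
have T0 := T_gt0; have et0 := eta_ge0; have ea := eta_alpha.
(* Half of the gap between [eta] and [alpha] becomes the rate in the mesh, the other half keeps the
   sums bounded. *)
pose d := (alpha - eta) / 2; have d0 : 0 < d by rewrite /d; lra.
have dalpha : 0 <= d <= alpha by rewrite /d; lra.
have ed : eta + d < alpha by rewrite /d; lra.
pose A x := (1 + (alpha - eta)^-1) * (2 * M * x `^ (alpha - eta)).
pose A' x := 2 * ((alpha - eta - d)^-1 * x `^ (alpha - eta - d)).
have ae1 : 0 < (alpha - eta)^-1 by rewrite invr_gt0; lra.
have ae2 : 0 < (alpha - eta - d)^-1 by rewrite invr_gt0; lra.
have A0 x : 0 <= A x.
  by rewrite /A !mulr_ge0 ?powR_ge0//; lra.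
have A'0 x : 0 <= A' x by rewrite /A' !mulr_ge0 ?powR_ge0 ?(ltW ae2).
pose C := A' t' * (2 * M) * (A t * M) + A t' * (A' t * (2 * M) * M).
have C0 : 0 <= C by apply: addr_ge0; do ?apply: mulr_ge0 => //; rewrite ?A0 ?A'0.
have e2 : 0 < e / 2 by rewrite divr_gt0.
have [D D0 DC] := powR_small C0 e2 d0.
exists D => // P S P' S' tP tS t'P' t'S' /ltW mP /ltW mS /ltW mP' /ltW mS'.
have hP := left_sum_functional bop_compBl bop_compBr norm_bop_comp T_gt0 eta_ge0 KM eta_alpha tT tP.
have hS := left_sum_functional bop_compBl bop_compBr norm_bop_comp T_gt0 eta_ge0 KM eta_alpha tT tS.
have hS' := left_sum_functional adj_mulBl adj_mulBr norm_adj_mul T_gt0 eta_ge0 KM eta_alpha t'T t'S'.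
have hPS := left_sum_cauchy_functional bop_compBl bop_compBr norm_bop_comp
  T_gt0 KM dalpha ed tT tP tS mP mS.
have hPS' := left_sum_cauchy_functional adj_mulBl adj_mulBr norm_adj_mul
  T_gt0 KM dalpha ed t'T t'P' t'S' mP' mS'.
(* Only the partitions change here, so the term of [holder_functional_tensor_diff] in which [Q]
   changes vanishes. *)
have QQ : rect_holder alpha T 0 (Q - Q).
  move=> s u s' u' _ _ _ _; by rewrite rect_incrB subrr normr0 !mul0r.
have h := holder_functional_tensor_diff hP hS hS' hPS hPS' (A0 t) _ M0 (lexx 0)
  (cov_norm_rect_incr T_gt0 QM) QQ.
rewrite !double_sumE; apply: le_lt_trans (h _) _.
  by rewrite !mulr_ge0 ?powR_ge0 ?(ltW ae2).
rewrite -/(A t) -/(A t') -/(A' t) -/(A' t') !mulr0 addr0.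
apply: (@le_lt_trans _ _ (C * D `^ d)); last by lra.
by rewrite /C le_eqVlt; apply/orP; left; apply/eqP; ring.
Qed.

Lemma double_integral_cvg t t' : 0 <= t <= T -> 0 <= t' <= T ->
  double_sum dot K Q t t' PP.1 PP.2
    @[PP --> filter_prod (mesh_to0 0 t) (mesh_to0 0 t')]
  --> double_integral dot K Q t t'.
Proof.
move=> tT t'T; have /andP[t0 _] := tT; have /andP[t'0 _] := t'T.
have Ft := mesh_to0_filter t0; have Ft' := mesh_to0_filter t'0.
apply: bop_cauchy_cvg; apply: cauchy_exP => e e0.
have [D D0 hD] := double_sum_cauchy tT t'T e0.
have [P0 tP0 mP0] := exists_fine_partition t0 D0.
have [P0' tP0' mP0'] := exists_fine_partition t'0 D0.
exists (double_sum dot K Q t t' P0 P0').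
exists ([set P | itv_partition 0 t P /\ mesh 0 P < D],
        [set P | itv_partition 0 t' P /\ mesh 0 P < D]).
  by split; exists D.
move=> [P P'] /= [[tP mP] [tP' mP']]; rewrite -ball_normE /=.
exact: hD.
Qed.

Lemma double_integral_approx t t' e : 0 <= t <= T -> 0 <= t' <= T -> 0 < e ->
  exists2 D, 0 < D & forall P P',
    itv_partition 0 t P -> itv_partition 0 t' P' -> mesh 0 P < D -> mesh 0 P' < D ->
    `|double_integral dot K Q t t' - double_sum dot K Q t t' P P'| <= e.
Proof.
move=> tT t'T e0; have /andP[t0 _] := tT; have /andP[t'0 _] := t'T.
have Ft := mesh_to0_filter t0; have Ft' := mesh_to0_filter t'0.
have /cvgrPdist_le/(_ _ e0) := double_integral_cvg tT t'T.
move=> [[A B] /= [[D D0 DA] [D' D'0 DB]] AB].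
exists (Num.min D D') => [|P P' tP tP']; first by rewrite lt_min D0.
rewrite !lt_min => /andP[mP _] /andP[_ mP'].
by apply: (AB (P, P')); split; [exact: DA|exact: DB].
Qed.

Definition double_sum_incr s s' t t' Ps Pt Ps' Pt' :=
  left_sum_incr adj_mul K s' t' Ps' Pt'
    (fun r' => left_sum_incr (@bop_comp R H) K s t Ps Pt (Q ^~ r')).

(** All four corners use partitions built from [Ps], [Pt], [Ps'] and [Pt'], so the four double sums
    combine exactly into a composition of two increments; each corner contributes an error e / 4. *)
Lemma double_integral_incr_approx s s' t t' e : 0 <= s <= t -> t <= T ->
  0 <= s' <= t' -> t' <= T -> 0 < e ->
  exists2 D, 0 < D & forall Ps Pt Ps' Pt',
    itv_partition 0 s Ps -> itv_partition s t Pt ->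
    itv_partition 0 s' Ps' -> itv_partition s' t' Pt' ->
    mesh 0 Ps < D -> mesh s Pt < D -> mesh 0 Ps' < D -> mesh s' Pt' < D ->
    `|rect_incr (double_integral dot K Q) s s' t t'
      - double_sum_incr s s' t t' Ps Pt Ps' Pt'| <= e.
Proof.
move=> st tT st' tT' e0; have e4 : 0 < e / 4 by rewrite divr_gt0.
have sI : 0 <= s <= T by lra.
have tI : 0 <= t <= T by lra.
have sI' : 0 <= s' <= T by lra.
have tI' : 0 <= t' <= T by lra.
have [D1 D10 h1] := double_integral_approx tI tI' e4.
have [D2 D20 h2] := double_integral_approx tI sI' e4.
have [D3 D30 h3] := double_integral_approx sI tI' e4.
have [D4 D40 h4] := double_integral_approx sI sI' e4.
exists (Num.min (Num.min D1 D2) (Num.min D3 D4)).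
  by rewrite !lt_min D10 D20 D30 D40.
move=> Ps Pt Ps' Pt' sP tP sP' tP'; rewrite !lt_min.
move=> /andP[/andP[s1 s2] /andP[s3 s4]] /andP[/andP[t1 t2] /andP[t3 t4]].
move=> /andP[/andP[s1' s2'] /andP[s3' s4']] /andP[/andP[t1' t2'] /andP[t3' t4']].
have tPP := itv_partition_cat sP tP; have tPP' := itv_partition_cat sP' tP'.
have mPt D : mesh 0 Ps < D -> mesh s Pt < D -> mesh 0 (Ps ++ Pt) < D.
  by move=> ? ?; rewrite (mesh_cat _ sP) gt_max; apply/andP.
have mPt' D : mesh 0 Ps' < D -> mesh s' Pt' < D -> mesh 0 (Ps' ++ Pt') < D.
  by move=> ? ?; rewrite (mesh_cat _ sP') gt_max; apply/andP.
have {}h1 := h1 _ _ tPP tPP' (mPt _ s1 t1) (mPt' _ s1' t1').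
have {}h2 := h2 _ _ tPP sP' (mPt _ s2 t2) s2'.
have {}h3 := h3 _ _ sP tPP' s3 (mPt' _ s3' t3').
have {}h4 := h4 _ _ sP sP' s4 s4'.
have -> : double_sum_incr s s' t t' Ps Pt Ps' Pt' =
    (double_sum dot K Q t t' (Ps ++ Pt) (Ps' ++ Pt')
     - double_sum dot K Q s t' Ps (Ps' ++ Pt'))
    - (double_sum dot K Q t s' (Ps ++ Pt) Ps' - double_sum dot K Q s s' Ps Ps').
  by rewrite !double_sumE -!(left_sumBr adj_mulBr).
rewrite /rect_incr; set I := double_integral dot K Q in h1 h2 h3 h4 *.
move: (double_sum _ _ _ t t' _ _) (double_sum _ _ _ t s' _ _) h1 h2.
move: (double_sum _ _ _ s t' _ _) (double_sum _ _ _ s s' _ _) h3 h4.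
move=> c d hc hd a b ha hb.
have swap (x y z w : 'L(H)) : (x - y) - (z - w) = (x - z) - (y - w).
  by rewrite opprD addrACA -opprD.
have -> : I t t' - I t s' - I s t' + I s s' - (a - c - (b - d)) =
    (I t t' - a) - (I t s' - b) - (I s t' - c) + (I s s' - d).
  rewrite (swap (I t t')) (swap (I t t' - I t s')) addrACA -opprD; congr (_ - _).
  by rewrite opprB addrA addrAC [a - c - b]addrAC.
have := ler_normD (I t t' - a - (I t s' - b) - (I s t' - c)) (I s s' - d).
have := ler_normB (I t t' - a - (I t s' - b)) (I s t' - c).
have := ler_normB (I t t' - a) (I t s' - b).
by move: (`|_|) (`|_|) (`|_|) ha hb hc hd => *; lra.
Qed.

End Convergence.

(** The only partition of [0, 0] is the empty list, so the double sums are eventually 0. *)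
Lemma double_integral_edge K Q t : 0 <= t ->
  double_integral dot K Q t 0 = 0 /\ double_integral dot K Q 0 t = 0.
Proof.
move=> t0; have Ft := mesh_to0_filter t0; have F0 := mesh_to0_filter (lexx (0 : R)).
have part0 : mesh_to0 0 0 [set P : seq R | P = [::]].
  by exists 1 => // P /itv_partitionxx.
split; apply: norm_lim_near_cst.
  exists (setT, [set P | P = [::]]); first by split=> //; exact: filterT.
  by move=> [P P'] /= [_ P0]; apply: double_sum_nil; right.
exists ([set P | P = [::]], setT); first by split=> //; exact: filterT.
by move=> [P P'] /= [P0 _]; apply: double_sum_nil; left.
Qed.

End Estimates.
End DoubleIntegrals.

(** * Lipschitz estimate for the map from kernel and covariance to the double integral *)

Theorem proposition21 (R : realType) (T : R) (hT : 0 < T)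
  (H : completeNormedModType R) (dot : {dot H for idfun})
  (hdot : forall x : H, `|x| ^+ 2 = dot x x)
  (hsep : separable_space H)
  (eta : R) (heta : 0 < eta < 1)
  (alpha : R) (halpha : eta < alpha <= 1)
  (M : R) (hM : 0 < M)
  (zeta : R) (hzeta : 0 <= zeta < alpha - eta) :
  exists C : R,
    forall K Kt Q Qt : R -> R -> 'L(H),
      kernel_class T eta K -> kernel_class T eta Kt ->
      cov_class T alpha Q -> cov_class T alpha Qt ->
      (maxe (maxe (maxe (kernel_norm T eta K) (kernel_norm T eta Kt))
              (cov_norm T alpha Q)) (cov_norm T alpha Qt) <= M%:E)%E ->
      (cov_norm T zeta (double_integral dot K Q - double_integral dot Kt Qt)%R
         <= C%:E * (kernel_norm T eta (K - Kt)%R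
                    + cov_norm T alpha (Q - Qt)%R))%E.
Proof.
have eta0 : 0 <= eta by lra.
have ea : eta < alpha by lra.
have zeta0 : 0 <= zeta by lra.
have zeta01 : 0 <= zeta <= 1 by lra.
have ez : eta + zeta < alpha by lra.
pose kap := alpha - (eta + zeta); have k0 : 0 < kap by rewrite /kap; lra.
(* The constant of [left_sum_incr_functional], stripped of the kernel bound and of the power of t -
   s. *)
pose c := 4 * (1 + kap^-1) * T `^ kap.
have c0 : 0 < c by rewrite /c !mulr_gt0 ?powR_gt0// addr_gt0 ?invr_gt0.
(* The three terms of [holder_functional_tensor_diff] will add up to c^2 M^2 (2k + q), up to the
   powers of the increments, which explains the 2. [Tz] is the price paid in [cov_norm_le] for the
   one-parameter seminorms. *)
pose C0 := 2 * (c * c * (M * M)); pose Tz := 1 + 2 * T `^ zeta.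
have Tz0 : 0 < Tz by rewrite /Tz ltr_wpDr// mulr_ge0 ?powR_ge0.
have C00 : 0 < C0 by apply: mulr_gt0 => //; apply: mulr_gt0; apply: mulr_gt0.
exists (C0 * Tz) => K Kt Q Qt _ _ _ _.
rewrite !ge_max => /andP[/andP[/andP[KM KtM] QM] QtM].
have := kernel_norm_ge0 eta (K - Kt) hT; have := cov_norm_ge0 alpha (Q - Qt) hT.
(* If one of the two differences has infinite norm, the right-hand side is +oo, its factor [C0 * Tz]
   being positive. This spares a triangle inequality for the norms. *)
case EQ : (cov_norm T alpha (Q - Qt)) => [q| |] // q0; last first.
  move=> k_ge0; rewrite addey ?gt_eqF// ?(lt_le_trans _ k_ge0)//.
  by rewrite gt0_muley ?lee_fin ?leey// lte_fin mulr_gt0.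
case EK : (kernel_norm T eta (K - Kt)) => [k| |] // k_ge0; last first.
  by rewrite addye// gt0_muley ?leey// lte_fin mulr_gt0.
have {}EQ : (cov_norm T alpha (Q - Qt)%R <= q%:E)%E by rewrite EQ.
have {}EK : (kernel_norm T eta (K - Kt)%R <= k%:E)%E by rewrite EK.
rewrite !lee_fin in q0 k_ge0; rewrite -EFinD -EFinM.
have -> : C0 * Tz * (k + q) = C0 * (k + q) * Tz by ring.
have N0 : 0 <= C0 * (k + q) by rewrite mulr_ge0 ?addr_ge0// ltW.
apply: cov_norm_le => //; last first.
  move=> t /andP[t0 _].
  have [e1 e2] := double_integral_edge dot K Q t0.
  have [e3 e4] := double_integral_edge dot Kt Qt t0.
  by split; rewrite !fctE ?e1 ?e2 ?e3 ?e4 subrr.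
move=> s t s' t' st tT st' tT'; rewrite rect_incrB.
(* The slack [e] pays for replacing the integrals by sums, e / 2 for each of the two integrals; the
   sums themselves satisfy the bound. *)
apply/ler_addgt0Pr => e e0.
have st1 : 0 <= s <= t by lra.
have st1' : 0 <= s' <= t' by lra.
have e2 : 0 < e / 2 by rewrite divr_gt0.
have [D D0 hD] := double_integral_incr_approx hdot hT eta0 ea KM QM st1 tT st1' tT' e2.
have [D' D'0 hD'] :=
  double_integral_incr_approx hdot hT eta0 ea KtM QtM st1 tT st1' tT' e2.
(* The partitions must be fine enough for both integrals at once, since the two sums are compared on
   the same partitions. *)
have m0 : 0 < Num.min D D' by rewrite lt_min D0.
have s0 : 0 <= s by lra.
have s0' : 0 <= s' by lra.
have stl : s <= t by lra.
have stl' : s' <= t' by lra.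
have [Ps sP] := exists_fine_partition s0 m0; rewrite lt_min => /andP[mPs mPs1].
have [Pt tP] := exists_fine_partition stl m0; rewrite lt_min => /andP[mPt mPt1].
have [Ps' sP'] := exists_fine_partition s0' m0; rewrite lt_min => /andP[mPs' mPs1'].
have [Pt' tP'] := exists_fine_partition stl' m0; rewrite lt_min => /andP[mPt' mPt1'].
have {}hD := hD _ _ _ _ sP tP sP' tP' mPs mPt mPs' mPt'.
have {}hD' := hD' _ _ _ _ sP tP sP' tP' mPs1 mPt1 mPs1' mPt1'.
have fl := left_sum_incr_functional (@bop_compBl R H) (@bop_compBr R H)
  (@norm_bop_comp R H) hT eta0.
have fr := left_sum_incr_functional (adj_mulBl hdot) (@adj_mulBr R H dot)
  (norm_adj_mul hdot) hT eta0.
have lK := fl _ _ _ KM _ _ _ _ _ zeta01 ez st tT sP tP.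
have lKt := fl _ _ _ KtM _ _ _ _ _ zeta01 ez st tT sP tP.
have lB := fl _ _ _ EK _ _ _ _ _ zeta01 ez st tT sP tP.
have rKt := fr _ _ _ KtM _ _ _ _ _ zeta01 ez st' tT' sP' tP'.
have rB := fr _ _ _ EK _ _ _ _ _ zeta01 ez st' tT' sP' tP'.
rewrite -/kap -/c in lK lKt lB rKt rB.
clearbody c.
(* The sums are additive in the kernel, so the difference of the functionals of [K] and [Kt] is the
   functional of [K - Kt], whose constant is proportional to [k]. *)
have {}lB : holder_functional alpha T (c * k * (t - s) `^ zeta)
  (fun f => left_sum_incr (@bop_comp R H) K s t Ps Pt f
    - left_sum_incr (@bop_comp R H) Kt s t Ps Pt f).
  suff -> : (fun f => left_sum_incr (@bop_comp R H) K s t Ps Pt f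
    - left_sum_incr (@bop_comp R H) Kt s t Ps Pt f) =
    left_sum_incr (@bop_comp R H) (K - Kt) s t Ps Pt by [].
  by apply/funext => f; rewrite left_sum_incrB//; exact: bop_compBl.
have {}rB : holder_functional alpha T (c * k * (t' - s') `^ zeta)
  (fun f => left_sum_incr (adj_mul dot) K s' t' Ps' Pt' f
    - left_sum_incr (adj_mul dot) Kt s' t' Ps' Pt' f).
  suff -> : (fun f => left_sum_incr (adj_mul dot) K s' t' Ps' Pt' f
    - left_sum_incr (adj_mul dot) Kt s' t' Ps' Pt' f) =
    left_sum_incr (adj_mul dot) (K - Kt) s' t' Ps' Pt' by [].
  by apply/funext => f; rewrite left_sum_incrB//; exact: (adj_mulBl hdot).
have := holder_functional_tensor_diff lK lKt rKt lB rB _ _ _ q0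
  (cov_norm_rect_incr hT QM) (cov_norm_rect_incr hT EQ).
set a := (t - s) `^ zeta; set a' := (t' - s') `^ zeta.
have a0 : 0 <= a by exact: powR_ge0.
have a'0 : 0 <= a' by exact: powR_ge0.
clearbody a a'; have M0 := ltW hM; have cge0 := ltW c0.
rewrite !mulr_ge0// => /(_ isT isT M0) hb.
rewrite -[X in `|X|](subrK (double_sum_incr dot K Q s s' t t' Ps Pt Ps' Pt'
  - double_sum_incr dot Kt Qt s s' t t' Ps Pt Ps' Pt')).
apply: le_trans (ler_normD _ _) _; rewrite addrC; apply: lerD.
  apply: le_trans hb _.
  have -> : c * k * a' * (c * M * a * M) + c * M * a' * (c * k * a * M)
      + c * M * a' * (c * M * a * q) = (2 * k + q) * (c * c * (M * M) * (a * a'))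
    by ring.
  have -> : C0 * (k + q) * a * a' =
    (2 * k + 2 * q) * (c * c * (M * M) * (a * a')) by rewrite /C0; ring.
  by rewrite ler_wpM2r ?mulr_ge0//; lra.
move: hD hD'; move: (rect_incr (double_integral dot K Q) _ _ _ _).
move: (rect_incr (double_integral dot Kt Qt) _ _ _ _) => X Y hD hD'.
rewrite opprD addrACA -opprD [e]splitr.
by apply: le_trans (ler_normB _ _) (lerD hD hD').
Qed.
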